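(* Let $\theta>0$, $h>0$, and let $B=\mathcal{C}([0,h])$ be the Banach space of real-valued continuous functions on $[0,h]$ with the supremum norm $\|\cdot\|_B$. Let $\{\xi_t,\ t\in\mathbb{R}\}$ be the (zero-mean) Ornstein-Uhlenbeck process with parameter $\theta$, let $X_n(t)=\xi_{nh+t}$ for $0\le t\le h$, $n\in\mathbb{Z}$, and for each integer $n\ge 1$ let $\widehat{\theta}_n$ be the maximum likelihood estimator of $\theta$ based on the observation of $\xi$ on $[0,T]$ with $T=nh$. Then the plug-in predictor $\widehat{X}_n=\rho_{\widehat{\theta}_n}(X_{n-1})$ is consistent in $B$, i.e. $$\left\|(\rho_\theta-\rho_{\widehat{\theta}_n})(X_{n-1})\right\|_B\longrightarrow 0\quad\text{in probability, as } n\to\infty.$$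
   Context: $W=\{W_t,\ t\in\mathbb{R}\}$ is a standard bilateral (two-sided) Wiener process on a probability space $(\Omega,\mathcal{A},\mathcal{P})$. The Ornstein-Uhlenbeck (O.U.) process with parameter $\theta>0$ is the zero-mean stationary Gaussian process with continuous sample paths $\xi_t=\int_{-\infty}^{t}e^{-\theta(t-s)}\,dW_s$, $t\in\mathbb{R}$ (covariance $\frac{1}{2\theta}e^{-\theta|t-s|}$). For a real number $u$, the operator $\rho_u$ is defined by $\rho_u(x)(t)=e^{-ut}x(h)$, $0\le t\le h$, $x\in B$. Thus $\widehat{X}_n(t)=\rho_{\widehat{\theta}_n}(X_{n-1})(t)=e^{-\widehat{\theta}_n t}X_{n-1}(h)$, $0\le t\le h$. The maximum likelihood estimator of $\theta$ based on $\{\xi_t,\ t\in[0,T]\}$ is $$\widehat{\theta}_T=\frac{1+\frac{\xi_0^2}{T}-\frac{\xi_T^2}{T}}{\frac{2}{T}\int_0^T\xi_t^2\,dt},\quad T>0,$$ and $\widehat{\theta}_n$ denotes this estimator with $T=nh$. *)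

(* Defs.v *)
(* MathComp-Analysis, over an arbitrary R : realType. *)
From HB Require Import structures.
From mathcomp Require Import all_boot all_order all_algebra.
From mathcomp Require Import all_classical all_reals all_analysis.

Set Implicit Arguments.
Unset Strict Implicit.
Unset Printing Implicit Defensive.

Import Order.TTheory GRing.Theory Num.Theory.
Import numFieldNormedType.Exports.

Local Open Scope classical_set_scope.
Local Open Scope ring_scope.

Section Processes.
Context (d : measure_display) (T : measurableType d) (R : realType).
Variable P : probability T R.

(* The case s = 0 is needed because the library's normal_prob m 0 is the
   uniform law on [0, 1], whereas a degenerate Gaussian law is a Dirac mass. *)
Definition gaussian_law (m s : R) (A : set R) : \bar R :=
  if s == 0 then \d_m A else normal_prob m s A.

Definition gaussian_rv (X : T -> R) : Prop :=
  exists m s : R,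
    forall A : set R, measurable A -> P (X @^-1` A) = gaussian_law m s A.

Definition gaussian_process (Y : R -> {RV P >-> R}) : Prop :=
  forall (k : nat) (c t : 'I_k -> R),
    gaussian_rv (fun w => \sum_(i < k) c i * Y (t i) w).

(* (|s| + |t| - |t - s|) / 2 is min(|s|, |t|) if s and t have the same sign
   and 0 otherwise: on each side of 0, W is a Wiener process started at 0, and
   the two sides are independent. *)
Record bilateral_wiener (W : R -> {RV P >-> R}) : Prop := BilateralWiener {
  wiener_gaussian : gaussian_process W;
  wiener_mean : forall t, ('E_P[W t] = 0)%E;
  wiener_cov : forall s t,
    covariance P (W s) (W t) = ((`|s| + `|t| - `|t - s|) / 2)%:E;
  wiener_continuous : forall w, continuous (fun t => W t w)
}.

(* The step function \sum_i c_i 1_(t_i, t_(i+1)], i < k. *)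
Record step := Step {
  step_size : nat;
  step_coef : nat -> R;
  step_node : nat -> R;
  step_node_nondecreasing : nondecreasing_seq step_node
}.

Definition step_fun (s : step) (x : R) : R :=
  \sum_(i < step_size s)
    step_coef s i * \1_(`]step_node s i, step_node s i.+1]) x.

Definition step_integral (W : R -> {RV P >-> R}) (s : step) (w : T) : R :=
  \sum_(i < step_size s)
    step_coef s i * (W (step_node s i.+1) w - W (step_node s i) w).

(* Y is (a version of) the Wiener integral of f over the real line: the limit
   in L^2(P) of the integrals of step functions converging to f in
   L^2(Lebesgue). *)
Definition wiener_integral (W : R -> {RV P >-> R}) (f : R -> R) (Y : T -> R) :
    Prop :=
  exists s : nat -> step,
    (\int[lebesgue_measure]_x ((f x - step_fun (s n) x) ^+ 2)%:E)%E
      @[n --> \oo] --> 0%E /\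
    ('E_P[(fun w => (Y w - step_integral W (s n) w) ^+ 2)%R])%E
      @[n --> \oo] --> 0%E.

Record ornstein_uhlenbeck (W : R -> {RV P >-> R}) (theta : R)
    (xi : R -> {RV P >-> R}) : Prop := OrnsteinUhlenbeck {
  ou_integral : forall t, wiener_integral W
    (fun s => \1_(`]-oo, t]) s * expR (- theta * (t - s))) (xi t);
  ou_continuous : forall w, continuous (fun t => xi t w)
}.

(* The estimator in closed form, from the observation of xi on [0, S]; the
   integral is a real-valued Lebesgue integral of a continuous path. *)
Definition mle (xi : R -> {RV P >-> R}) (S : R) (w : T) : R :=
  (1 + xi 0 w ^+ 2 / S - xi S w ^+ 2 / S) /
  (2 / S * \int[lebesgue_measure]_(t in `[0, S]) (xi t w ^+ 2)).

(* The events below are measurable as soon as all Y n and Z are. *)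
Definition cvg_in_probability (Y : nat -> T -> R) (Z : T -> R) : Prop :=
  forall e : R, 0 < e ->
    P [set w | e < `|Y n w - Z w|] @[n --> \oo] --> 0%E.

End Processes.

Arguments ou_continuous {d T R P W theta xi} _ w.

Section Paths.
Variable R : realType.

Definition segment (h : R) : topologicalType := set_type `[0, h]%classic.

(* The space C([0, h]). *)
Definition B (h : R) : Type := continuousType (segment h) R.

Definition supnorm (h : R) (x : B h) : R := sup (range (fun t => `|x t|)).

Lemma B_sub_continuous (h : R) (x y : B h) : continuous (fun t => x t - y t).
Proof. by move=> t; apply: continuousB; exact: cts_fun. Qed.

Definition B_sub (h : R) (x y : B h) : B h := mkcts (@B_sub_continuous h x y).

Lemma endpoint_subproof (h : R) (h0 : 0 < h) : h \in `[0, h]%classic.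
Proof. by rewrite inE /= in_itv /= lexx ltW. Qed.

Definition endpoint (h : R) (h0 : 0 < h) : segment h :=
  exist _ h (endpoint_subproof h0).

Lemma restrict_continuous (h : R) (f : R -> R) (hf : continuous f) :
  continuous (fun t : segment h => f (set_val t)).
Proof.
move=> t; apply: (@continuous_comp _ _ _ (fun t : segment h => set_val t) f).
  exact: initial_continuous.
exact: hf.
Qed.

Definition restrict (h : R) (f : R -> R) (hf : continuous f) : B h :=
  mkcts (@restrict_continuous h f hf).

Lemma rho_continuous (u c : R) : continuous (fun t : R => expR (- u * t) * c).
Proof.
move=> t; apply: cvgM; last exact: cvg_cst.
apply: (@continuous_comp _ _ _ (fun t : R => - u * t) expR).
  exact: mulrl_continuous.
exact: continuous_expR.
Qed.

Definition rho (h : R) (h0 : 0 < h) (u : R) (x : B h) : B h :=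
  restrict h (@rho_continuous u (x (endpoint h0))).

Lemma block_continuous (h : R) (x : R -> R) (hx : continuous x) (n : int) :
  continuous (fun t : R => x (n%:~R * h + t)).
Proof.
move=> t; apply: (@continuous_comp _ _ _ (fun t : R => n%:~R * h + t) x).
  by apply: cvgD; [exact: cvg_cst | exact: cvg_id].
exact: hx.
Qed.

Definition block (h : R) (x : R -> R) (hx : continuous x) (n : int) : B h :=
  restrict h (@block_continuous h x hx n).

End Paths.

(* Main.v *)
(* The estimator only sees xi through A_n = (1 / nh) int_0^(nh) xi^2, xi_0 and
   xi_(nh), so everything follows from A_n --> v := 1 / (2 theta) in L^1
   together with E xi_t^2 = v, which makes xi_0 and xi_(nh) tight.
   Cutting [0, nh] into n translates of [0, h] gives
     A_n - v = (1 / h) int_0^h (1 / n) sum_(k < n) (xi_(kh + u)^2 - v) du,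
   and by Tonelli it suffices to bound, uniformly in u, the L^1 norm of the
   average over the grid.  Replacing each xi_(kh + u) by the integral S_k of a
   step function, which is an exact Gaussian combination of values of W,
   polarization of E Z^4 = 3 (E Z^2)^2 yields
     E S_k^2 S_l^2 = E S_k^2 E S_l^2 + 2 (E S_k S_l)^2,
   and E S_k S_l tends to v exp (- theta h |k - l|) by the Wiener isometry, so
   that the variance of the sum is O(n).  Only second moments of the differences
   xi_(kh + u) - S_k enter the limit: the law of xi itself is never needed. *)
Require Import Defs.
From mathcomp Require Import all_boot all_order all_algebra.
From mathcomp Require Import all_classical all_reals all_analysis.
From mathcomp Require Import measurable_realfun.
From mathcomp Require Import ring lra.
Import Order.TTheory GRing.Theory Num.Theory.
Import numFieldNormedType.Exports.
Local Open Scope classical_set_scope.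
Local Open Scope ring_scope.

(** * Square-integrable functions *)

(** Two features of the hypotheses shape the proof. [wiener_integral] gives [xi t] only as an L^2
    limit, so neither its Gaussianity nor its fourth moment is at hand. The variance bound is
    therefore stated for step integrals at a finite stage m and turned into an L^1 bound by
    [|z| <= dl + z ^+ 2 / dl], which survives the limit in m and avoids square roots; for a variance
    O(n), taking [dl] a small multiple of n leaves that multiple plus a constant. Moreover, the
    final event involves a supremum, and its measurability must be established before the
    monotonicity of [P] applies; this is done by reduction to rational times. The remaining step is
    deterministic: off three exceptional events the estimator is close to [theta], hence
    nonnegative, and on [u >= 0] the map from [u] to [exp (- u t)], for t in [0, h], is Lipschitz
    with constant h. The error also carries the factor [xi_(nh)], unbounded but tight. *)

Section square_integrable.
Context {d} {T : measurableType d} {R : realType}.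
Variable mu : {measure set T -> \bar R}.
Implicit Types f g : T -> R.

Definition sqint f := measurable_fun setT f /\
  mu.-integrable setT (EFin \o (fun x => f x ^+ 2)).

Lemma integrable_le f g : measurable_fun setT f ->
  mu.-integrable setT (EFin \o g) -> (forall x, `|f x| <= g x) ->
  mu.-integrable setT (EFin \o f).
Proof.
move=> mf ig fg; apply: le_integrable ig => //; first exact/measurable_EFinP.
by move=> x _ /=; rewrite lee_fin (le_trans (fg x))// ler_norm.
Qed.

Lemma integrable_mfun f : mu.-integrable setT (EFin \o f) ->
  measurable_fun setT f.
Proof. by move=> /measurable_int /measurable_EFinP. Qed.

Lemma integrable_add f g : mu.-integrable setT (EFin \o f) ->
  mu.-integrable setT (EFin \o g) ->
  mu.-integrable setT (EFin \o (fun x => f x + g x)).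
Proof. by move=> mf mg; exact: (integrableD measurableT mf mg). Qed.

Lemma integrable_scale c f : mu.-integrable setT (EFin \o f) ->
  mu.-integrable setT (EFin \o (fun x => c * f x)).
Proof. by move=> mf; exact: (integrableZl measurableT c mf). Qed.

Lemma integrable_bigsum (I : finType) (F : I -> T -> R) :
  (forall i, mu.-integrable setT (EFin \o F i)) ->
  mu.-integrable setT (EFin \o (fun x => \sum_i F i x)).
Proof.
move=> iF; rewrite (_ : _ \o _ = fun x => (\sum_i (F i x)%:E)%E).
  by apply: (integrable_sum measurableT) => i _; exact: iF.
by apply/funext => x /=; rewrite sumEFin.
Qed.

Lemma Rintegral_bigsum (I : finType) (F : I -> T -> R) :
  (forall i, mu.-integrable setT (EFin \o F i)) ->
  \int[mu]_x (\sum_i F i x) = \sum_i \int[mu]_x F i x.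
Proof.
move=> iF; rewrite /Rintegral.
under eq_integral do rewrite -sumEFin.
rewrite integral_sum//.
rewrite -sum_fine// => i _.
by apply: integrable_fin_num => //; exact: iF.
Qed.

Lemma sqint_mul f g : sqint f -> sqint g ->
  mu.-integrable setT (EFin \o (fun x => f x * g x)).
Proof.
move=> [mf f2] [mg g2]; apply: integrable_le (integrable_add _ _ f2 g2) _ => //.
  exact: measurable_funM.
by move=> x; rewrite ler_norml; nra.
Qed.

Lemma sqintD f g : sqint f -> sqint g -> sqint (fun x => f x + g x).
Proof.
move=> hf hg; split; first by apply: measurable_funD; [case: hf | case: hg].
rewrite (_ : (fun x => (f x + g x) ^+ 2) =
  fun x => (f x ^+ 2 + g x ^+ 2) + 2 * (f x * g x)); last first.
  by apply/funext => x; ring.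
apply: integrable_add; last exact/integrable_scale/sqint_mul.
by apply: integrable_add; [case: hf | case: hg].
Qed.

Lemma sqintZ c f : sqint f -> sqint (fun x => c * f x).
Proof.
move=> [mf f2]; split; first exact: measurable_funM.
under eq_fun do rewrite exprMn.
exact: integrable_scale.
Qed.

Lemma sqintB f g : sqint f -> sqint g -> sqint (fun x => f x - g x).
Proof.
move=> hf hg; have := sqintD _ _ hf (sqintZ (-1) _ hg).
by under eq_fun do rewrite mulN1r.
Qed.

Lemma sqint_sum (I : finType) (F : I -> T -> R) :
  (forall i, sqint (F i)) -> sqint (fun x => \sum_i F i x).
Proof.
move=> hF; rewrite (_ : (fun x => _) = \sum_i F i); last first.
  by apply/funext => x; rewrite fct_sumE.
apply: (big_ind sqint); last by [].
  split; first by have := measurable_cst (0 : R) : measurable_fun setT (cst 0 : T -> R).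
  rewrite (_ : _ \o _ = cst 0%E); first exact: integrable0.
  by apply/funext => x /=; rewrite expr0n.
by move=> f g hf hg; exact: sqintD.
Qed.

(** The integral is extended-real here: this is how [xi t] inherits square-integrability from a step
    integral at finite L^2 distance. *)
Lemma sqint_closeness f g : measurable_fun setT f -> sqint g ->
  (\int[mu]_x ((f x - g x) ^+ 2)%:E < +oo)%E -> sqint f.
Proof.
move=> mf hg fg; suff : sqint (fun x => f x - g x).
  by move=> /sqintD /(_ hg); under eq_fun do rewrite subrK.
have mfg : measurable_fun setT (fun x => f x - g x).
  by apply: measurable_funB => //; case: hg.
split=> //; apply/integrableP; split.
  exact/measurable_EFinP/measurable_funX.
rewrite (eq_integral (fun x => ((f x - g x) ^+ 2)%:E))// => x _ /=.
by rewrite ger0_norm// sqr_ge0.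
Qed.

Lemma Rintegral_sqr_ge0 f : 0 <= \int[mu]_x (f x ^+ 2).
Proof. by apply: Rintegral_ge0 => x _; exact: sqr_ge0. Qed.

(* Pointwise AM-GM with weight dl on the cross terms. *)
Lemma Rintegral_mul_dist f g f' g' dl : 0 < dl ->
  sqint f -> sqint g -> sqint f' -> sqint g' ->
  \int[mu]_x `|f' x * g' x - f x * g x| <=
  (1 + dl^-1) * (\int[mu]_x ((f x - f' x) ^+ 2) + \int[mu]_x ((g x - g' x) ^+ 2))
  + dl * (\int[mu]_x (f x ^+ 2) + \int[mu]_x (g x ^+ 2)).
Proof.
move=> dl0 hf hg hf' hg'.
have i1 := sqint_mul _ _ hf' hg'; have i2 := sqint_mul _ _ hf hg.
have [mA iA] := sqintB _ _ hf hf'; have [mB iB] := sqintB _ _ hg hg'.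
have [mf if2] := hf; have [mg ig2] := hg.
have idiff := integrable_add _ _ i1 (integrable_scale (-1) _ i2).
have {}idiff : mu.-integrable setT
    (EFin \o (fun x => f' x * g' x - f x * g x)).
  by move: idiff; under eq_fun do rewrite mulN1r.
rewrite -!RintegralD// -!RintegralZl//; last 2 first.
  exact: integrable_add.
  exact: integrable_add.
rewrite -RintegralD//; last 2 first.
  exact/integrable_scale/integrable_add.
  exact/integrable_scale/integrable_add.
apply: le_Rintegral => //.
- exact: integrable_norm.
- by apply: integrable_add; exact/integrable_scale/integrable_add.
move=> x _; set a := f x - f' x; set b := g x - g' x.
have -> : f' x * g' x - f x * g x = a * b - a * g x - f x * b.
  by rewrite /a /b; ring.
have dlv : dl * dl^-1 = 1 by rewrite divff// gt_eqF.
have dli : 0 < dl^-1 by rewrite invr_gt0.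
have amgm (p q : R) : `|p * q| <= dl^-1 * p ^+ 2 + dl * q ^+ 2.
  have -> : dl^-1 * p ^+ 2 = dl * (dl^-1 * p) ^+ 2.
    by rewrite exprMn [dl^-1 ^+ 2]expr2 !mulrA dlv mul1r.
  rewrite {1}(_ : p = dl * (dl^-1 * p)); last by rewrite mulrA dlv mul1r.
  rewrite -mulrA -mulrDr normrM (gtr0_norm dl0) ler_pM2l// ler_norml.
  by nra.
have h1 := amgm a (g x); have h2 := amgm b (f x).
have h3 : `|a * b| <= a ^+ 2 + b ^+ 2 by rewrite ler_norml; nra.
rewrite [f x * b]mulrC.
have := ler_normB (a * b - a * g x) (b * f x).
have := ler_normB (a * b) (a * g x).
by lra.
Qed.

Lemma cvg_Rintegral_norm_mul f g (f_ g_ : nat -> T -> R) :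
  sqint f -> sqint g -> (forall n, sqint (f_ n)) -> (forall n, sqint (g_ n)) ->
  \int[mu]_x ((f x - f_ n x) ^+ 2) @[n --> \oo] --> (0 : R) ->
  \int[mu]_x ((g x - g_ n x) ^+ 2) @[n --> \oo] --> (0 : R) ->
  \int[mu]_x `|f_ n x * g_ n x - f x * g x| @[n --> \oo] --> (0 : R).
Proof.
move=> hf hg hf_ hg_ cf cg.
set K := \int[mu]_x (f x ^+ 2) + \int[mu]_x (g x ^+ 2).
have K0 : 0 <= K by rewrite addr_ge0// Rintegral_sqr_ge0.
(* [dl] is fixed first, so that [dl * K <= e / 2] ([K + 1] guards against [K = 0]); only then are
   the two L^2 distances made small against [C = 1 + dl^-1]. *)
apply/cvgr0Pnorm_le => e e0; pose dl := e / (2 * (K + 1)).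
have dl0 : 0 < dl by rewrite divr_gt0// mulr_gt0//; lra.
have dlK : dl * K <= e / 2.
  have -> : e / 2 = dl * (K + 1) by rewrite /dl; field; lra.
  by rewrite ler_pM2l//; lra.
pose C := 1 + dl^-1.
have C0 : 0 < C by rewrite addr_gt0// invr_gt0.
have e4 : 0 < e / (4 * C) by rewrite divr_gt0// mulr_gt0.
move/cvgr0Pnorm_le : cf => /(_ _ e4) nf.
move/cvgr0Pnorm_le : cg => /(_ _ e4) ng.
apply: filterS2 nf ng => n an bn.
rewrite ger0_norm ?Rintegral_sqr_ge0// in an.
rewrite ger0_norm ?Rintegral_sqr_ge0// in bn.
rewrite ger0_norm ?Rintegral_ge0// (le_trans (Rintegral_mul_dist f g (f_ n) (g_ n) dl dl0 hf hg (hf_ n) (hg_ n)))//.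
rewrite -/K -/C.
have : C * (\int[mu]_x (f x - f_ n x) ^+ 2 + \int[mu]_x (g x - g_ n x) ^+ 2)
    <= C * (e / (4 * C) + e / (4 * C)) by rewrite ler_pM2l//; lra.
have -> : C * (e / (4 * C) + e / (4 * C)) = e / 2 by field; lra.
by lra.
Qed.

Lemma cvg_Rintegral_mul f g (f_ g_ : nat -> T -> R) :
  sqint f -> sqint g -> (forall n, sqint (f_ n)) -> (forall n, sqint (g_ n)) ->
  \int[mu]_x ((f x - f_ n x) ^+ 2) @[n --> \oo] --> (0 : R) ->
  \int[mu]_x ((g x - g_ n x) ^+ 2) @[n --> \oo] --> (0 : R) ->
  \int[mu]_x (f_ n x * g_ n x) @[n --> \oo] --> \int[mu]_x (f x * g x).
Proof.
move=> hf hg hf_ hg_ cf cg.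
have := cvg_Rintegral_norm_mul _ _ _ _ hf hg hf_ hg_ cf cg.
move=> /cvgr0Pnorm_le h; apply/cvgrPdist_le => e /h.
apply: filterS => n; rewrite ger0_norm ?Rintegral_ge0//; apply: le_trans.
have i1 := sqint_mul _ _ (hf_ n) (hg_ n); have i2 := sqint_mul _ _ hf hg.
rewrite distrC -RintegralB//; apply: le_normr_Rintegral => //.
exact: (integrableB measurableT i1 i2).
Qed.

End square_integrable.

(** * Gaussian moments *)

Section normal_moments.
Context {R : realType}.
Local Notation mu := (@lebesgue_measure R).

Lemma cvg_Rintegral_itv (f : R -> R) : mu.-integrable setT (EFin \o f) ->
  \int[mu]_(x in `[- n%:R, n%:R]) f x @[n --> \oo] --> \int[mu]_x f x.
Proof.
move=> fi; have mf := integrable_mfun _ _ fi.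
pose f_ (n : nat) x := (EFin \o (f \_ `[- n%:R, n%:R])) x.
have mf_ n : measurable_fun setT (f_ n).
  apply/measurable_EFinP; apply/measurable_restrict => //.
  exact: measurable_funTS.
have [] := @dominated_convergence _ _ _ mu setT measurableT f_ (EFin \o f)
  (abse \o (EFin \o f)) mf_.
- exact/measurable_EFinP.
- apply: aeW => x _; apply: cvg_near_cst.
  near=> n; rewrite /f_ /= patchE ifT// inE /= in_itv /= -ler_norml.
  by near: n; exact: nbhs_infty_ger.
- exact: integrable_abse.
- apply: aeW => x n _; rewrite /f_ /= patchE lee_fin.
  by case: ifPn => // _; rewrite normr0.
move=> _ _ cv; rewrite /Rintegral.
apply: fine_cvg; rewrite fineK; last exact: integrable_fin_num.
rewrite (_ : (fun n : nat => _) =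
    fun n => (\int[mu]_x f_ n x)%E) //; apply/funext => n.
by rewrite integral_mkcond; apply: eq_integral => x _; rewrite restrict_EFin.
Unshelve. all: by end_near. Qed.

(** Fundamental theorem of calculus on [[-n, n]], then n to infinity: the last hypothesis makes [F]
    decay like [C / |x - m|], so the boundary terms vanish. *)
Lemma Rintegral_derive0 (F f : R -> R) (m C : R) :
  (forall x : R, is_derive x (1 : R) F (f x)) -> continuous f ->
  mu.-integrable setT (EFin \o f) ->
  (forall x, `|F x| * `|x - m| <= C) ->
  \int[mu]_x f x = 0.
Proof.
move=> dF cf fi FC; 
have /(@cvg_unique _ (@Rhausdorff R)) := cvg_Rintegral_itv _ fi; apply.
have cF : continuous F.
  by move=> x; apply/differentiable_continuous/derivable1_diffP.
have E (n : nat) : (0 < n)%N ->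
    \int[mu]_(x in `[- n%:R, n%:R]) f x = F n%:R - F (- n%:R).
  move=> n0; rewrite /Rintegral (@continuous_FTC2 _ f F).
  - by [].
  - by rewrite gtrN// ltr0n.
  - exact: continuous_subspaceT.
  - split; first by move=> x _; have := dF x; case.
    + by apply: cvg_at_right_filter; exact: cF.
    + by apply: cvg_at_left_filter; exact: cF.
  - by move=> x _; rewrite derive1E; apply: derive_val.
have C0 : 0 <= C by apply: le_trans (FC m); rewrite mulr_ge0.
(* The summand 1 keeps [|x - m|] positive even when [C = 0], so that it can be cancelled. *)
have Fsmall (e x : R) : 0 < e -> (C / e) + 1 <= `|x - m| -> `|F x| <= e.
  move=> e0 h; have Ce : 0 <= C / e by rewrite divr_ge0// ltW.
  rewrite -(ler_pM2r (_ : 0 < `|x - m|)); last by lra.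
  apply: le_trans (FC x) _.
  have -> : C = e * (C / e) by rewrite mulrC divfK// gt_eqF.
  by rewrite ler_pM2l//; lra.
apply/cvgr0Pnorm_le => e e0; near=> n.
have hn : (C / (e / 2)) + 1 + `|m| <= n%:R by near: n; exact: nbhs_infty_ger.
have e2 : 0 < e / 2 by rewrite divr_gt0.
have Ce : 0 <= C / (e / 2) by rewrite divr_ge0// ltW.
have n0 : (0 < n)%N by rewrite -(ltr0n R); have := normr_ge0 m; lra.
rewrite E//.
have /ler_normlP[m1 m2] := lexx `|m|.
have h1 : `|F n%:R| <= e / 2.
  by apply: Fsmall => //; rewrite ger0_norm; lra.
have h2 : `|F (- n%:R)| <= e / 2.
  by apply: Fsmall => //; rewrite ler0_norm; lra.
by have := ler_normB (F n%:R) (F (- n%:R)); lra.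
Unshelve. all: by end_near. Qed.

Let exprS_norm_le (y : R) k : (k <= 4)%N -> `|y| ^+ k <= 1 + y ^+ 4.
Proof.
move=> k4; have y4 : 0 <= y ^+ 4 by rewrite exprn_even_ge0.
have [y1|/ltW y1] := leP `|y| 1.
  by have := exprn_ile1 k (normr_ge0 y) y1; lra.
rewrite (le_trans (ler_weXn2l y1 k4))//.
by rewrite -normrX ger0_norm// lerDr.
Qed.

(* [normal_fun m s x = q ^+ 4] with [q = normal_fun m (2 * s) x], and
   [q <= (1 + y ^+ 2 / (8 * s ^+ 2))^-1] takes care of each factor [y ^+ 2]. *)
Let normal_fun_decay (m s x : R) : s != 0 ->
  (1 + (x - m) ^+ 4) * normal_fun m s x <=
  (1 + 64 * s ^+ 4) * normal_fun m (2 * s) x.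
Proof.
move=> s0; set y := x - m; set q := normal_fun m (2 * s) x.
have s2 : 0 < s ^+ 2 by rewrite exprn_even_gt0.
have qE : normal_fun m s x = q ^+ 4.
  rewrite /q /normal_fun -expRM_natl; congr expR.
  by field; rewrite s0.
have q0 : 0 < q by exact: expR_gt0.
set u := y ^+ 2 / (8 * s ^+ 2).
have u0 : 0 <= u by rewrite divr_ge0 ?sqr_ge0// mulr_ge0// ltW.
have qu : q * (1 + u) <= 1.
  have -> : q = (expR u)^-1.
    by rewrite -expRN /q /normal_fun; congr expR; rewrite /u /y; field; rewrite s0.
  by rewrite mulrC ler_pdivrMr ?expR_gt0// mul1r expR_ge1Dx.
have q1 : q <= 1 by nra.
have yq : y ^+ 2 * q <= 8 * s ^+ 2.
  have -> : y ^+ 2 = u * (8 * s ^+ 2) by rewrite /u divfK// mulf_neq0// gt_eqF.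
  by nra.
have y0 : 0 <= y ^+ 2 * q by rewrite mulr_ge0 ?sqr_ge0// ltW.
have yyq : y ^+ 4 * q ^+ 2 <= 64 * s ^+ 4.
  have -> : y ^+ 4 * q ^+ 2 = (y ^+ 2 * q) ^+ 2 by ring.
  have -> : 64 * s ^+ 4 = (8 * s ^+ 2) ^+ 2 by ring.
  by rewrite lerXn2r ?nnegrE// ltW// mulr_gt0.
rewrite qE.
have q2 : q ^+ 2 <= q by rewrite expr2 ger_pMr// ltW.
have q4 : q ^+ 4 <= q by rewrite (_ : q ^+ 4 = q ^+ 2 * q ^+ 2); nra.
rewrite mulrDl mulrDl !mul1r lerD//.
have -> : y ^+ 4 * q ^+ 4 = (y ^+ 4 * q ^+ 2) * q ^+ 2 by ring.
have y4 : 0 <= y ^+ 4 by rewrite exprn_even_ge0.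
have q2' : 0 <= q ^+ 2 by rewrite sqr_ge0.
by apply: ler_pM => //; exact: mulr_ge0.
Qed.

(** Domination by a multiple of the normal density with standard deviation [2 * s]; the ratio of
    peaks in [C] adjusts the two normalizations. *)
Lemma integrable_normal_moment (m s : R) k : s != 0 -> (k <= 4)%N ->
  mu.-integrable setT (EFin \o (fun x => (x - m) ^+ k * normal_pdf m s x)).
Proof.
move=> s0 k4; have s20 : 2 * s != 0 by rewrite mulf_neq0.
pose C := (1 + 64 * s ^+ 4) * normal_peak s / normal_peak (2 * s).
have := integrable_normal_pdf m (2 * s) => /(integrable_scale _ C) iC.
apply: integrable_le iC _ => [|x].
  apply: measurable_funM; last exact: measurable_normal_pdf.
  by apply: measurable_funX; exact: measurable_funB.
have p2 := normal_peak_gt0 s20; have p1 := normal_peak_gt0 s0.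
rewrite !normal_pdfE//.
have -> : C * (normal_peak (2 * s) * normal_fun m (2 * s) x) =
    normal_peak s * ((1 + 64 * s ^+ 4) * normal_fun m (2 * s) x).
  by rewrite /C; field; rewrite gt_eqF.
rewrite !normrM normrX (gtr0_norm p1) (ger0_norm (normal_fun_ge0 _ _ _)).
rewrite mulrCA ler_pM2l//.
apply: le_trans (normal_fun_decay m s x s0).
by rewrite ler_wpM2r ?normal_fun_ge0// exprS_norm_le.
Qed.

Let is_derive_normal_pdf (m s x : R) : s != 0 ->
  is_derive x (1 : R) (normal_pdf m s) (- (x - m) / s ^+ 2 * normal_pdf m s x).
Proof.
move=> s0; rewrite normal_pdfE//.
have dexp : is_derive x (1 : R) (normal_fun m s)
    (- (x - m) / s ^+ 2 * normal_fun m s x).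
  rewrite /normal_fun.
  have d1 : is_derive x (1 : R) (fun x : R => - (x - m) ^+ 2 / (s ^+ 2 *+ 2))
      (- (x - m) / s ^+ 2).
    apply: is_derive_eq; rewrite /GRing.scale /=.
    by field.
  apply: (is_derive_eq (is_derive1_comp _ _)).
  by rewrite mulrC.
apply: is_derive_eq; rewrite /GRing.scale /=; ring.
Qed.

(** Integration by parts: the derivative of [(x - m) ^+ k * normal_pdf m s x] integrates to 0, and
    its two terms carry the two moments. Decay and integrability involve degree [k.+1], hence
    [k <= 3]; for [k = 0] the factor [k%:R] makes the value of [k.-1] harmless. *)
Lemma normal_moment_rec (m s : R) k : s != 0 -> (k <= 3)%N ->
  \int[mu]_x ((x - m) ^+ k.+1 * normal_pdf m s x) =
  k%:R * s ^+ 2 * \int[mu]_x ((x - m) ^+ k.-1 * normal_pdf m s x).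
Proof.
move=> s0 k3.
have s2 : s ^+ 2 != 0 by rewrite expf_neq0.
have ik1 := integrable_normal_moment m s k.+1 s0 k3.
have ik : mu.-integrable setT (EFin \o (fun x => (x - m) ^+ k.-1 * normal_pdf m s x)).
  by apply: integrable_normal_moment => //; rewrite (leq_trans (leq_pred k))// leqW.
pose F x := (x - m) ^+ k * normal_pdf m s x.
pose f x := (- s ^- 2) * ((x - m) ^+ k.+1 * normal_pdf m s x) +
  k%:R * ((x - m) ^+ k.-1 * normal_pdf m s x).
have fi : mu.-integrable setT (EFin \o f).
  by apply: integrable_add; exact: integrable_scale.
have cp : continuous (normal_pdf m s) by exact: continuous_normal_pdf.
have cX j : continuous (fun x : R => (x - m) ^+ j).
  move=> x; apply: (@continuous_comp _ _ _ (fun x => x - m) (fun y => y ^+ j)).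
    by apply: continuousB; [exact: cvg_id | exact: cvg_cst].
  exact: exprn_continuous.
have : \int[mu]_x f x = 0.
  apply: (@Rintegral_derive0 F f m ((1 + 64 * s ^+ 4) * normal_peak s)).
  - move=> x; have := is_derive_normal_pdf m s x s0 => dp.
    have dX : is_derive x (1 : R) (fun x : R => (x - m) ^+ k)
        (k%:R * (x - m) ^+ k.-1).
      rewrite (_ : (fun x => _) = (fun x : R => x - m) ^+ k); last first.
        by apply/funext => z; rewrite exprfctE.
      by apply: is_derive_eq; rewrite /GRing.scale /=; ring.
    rewrite /F.
    apply: is_derive_eq; rewrite /GRing.scale /= /f [(x - m) ^+ k.+1]exprS.
    move: ((x - m) ^+ k) ((x - m) ^+ k.-1) (normal_pdf m s x) => a b c.
    by field.
  - rewrite /f => x; apply: cvgD; (apply: cvgM; first exact: cvg_cst);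
      (apply: cvgM; [exact: cX | exact: cp]).
  - exact: fi.
  - move=> x; have p1 := normal_peak_gt0 s0.
    rewrite /F normrM normrX mulrAC -exprSr normal_pdfE// normrM.
    rewrite (gtr0_norm p1) (ger0_norm (normal_fun_ge0 _ _ _)) mulrCA mulrC.
    rewrite ler_pM2r//.
    apply: le_trans (_ : _ <= (1 + (x - m) ^+ 4) * normal_fun m s x) _.
      by rewrite ler_wpM2r ?normal_fun_ge0// exprS_norm_le.
    apply: le_trans (normal_fun_decay m s x s0) _.
    have s4 : 0 <= s ^+ 4 by rewrite exprn_even_ge0.
    rewrite ger_pMr; last by lra.
    by rewrite /normal_fun -expR0 ler_expR mulNr oppr_le0 divr_ge0// ?mulrn_wge0// sqr_ge0.
rewrite /f RintegralD//; last 2 first.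
  exact: integrable_scale.
  exact: integrable_scale.
rewrite !RintegralZl// => E.
have {E} : s ^+ 2 * (- s ^- 2 * \int[mu]_x ((x - m) ^+ k.+1 * normal_pdf m s x)
   + k%:R * \int[mu]_x ((x - m) ^+ k.-1 * normal_pdf m s x)) = 0 by rewrite E mulr0.
rewrite mulrDr mulrA mulrN divff// mulN1r => /eqP; rewrite addrC subr_eq0 => /eqP <-.
by ring.
Qed.

Lemma normal_moment0 (m s : R) : \int[mu]_x normal_pdf m s x = 1.
Proof. by rewrite /Rintegral integral_normal_pdf. Qed.

Lemma normal_moments (m s : R) : s != 0 ->
  [/\ \int[mu]_x ((x - m) * normal_pdf m s x) = 0,
      \int[mu]_x ((x - m) ^+ 2 * normal_pdf m s x) = s ^+ 2 &
      \int[mu]_x ((x - m) ^+ 4 * normal_pdf m s x) = 3 * s ^+ 4].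
Proof.
move=> s0.
have h0 : \int[mu]_x ((x - m) ^+ 0 * normal_pdf m s x) = 1.
  by under eq_Rintegral do rewrite expr0 mul1r; exact: normal_moment0.
have := normal_moment_rec m s 0 s0 isT; have := normal_moment_rec m s 1 s0 isT.
have := normal_moment_rec m s 3 s0 isT; rewrite /= => -> -> h1; rewrite h0.
split; [|by rewrite mulr1 mul1r|by rewrite mulr1; ring].
by move: h1; rewrite mul0r mul0r.
Qed.

End normal_moments.

Section gaussian_moments.
Context {R : realType}.
Local Notation mu := (@lebesgue_measure R).

(** The change of variables holds with the Radon-Nikodym derivative, which agrees almost everywhere
    with [normal_pdf] because both have the same integral over every measurable set. *)
Lemma ge0_integral_normal_prob (m s : R) (f : R -> \bar R) :
  measurable_fun setT f -> (forall x, (0 <= f x)%E) ->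
  (\int[normal_prob m s]_x f x = \int[mu]_x (f x * (normal_pdf m s x)%:E))%E.
Proof.
move=> mf f0; have dom := normal_prob_dominates m s.
rewrite -(Radon_Nikodym_SigmaFinite.change_of_variables dom f0 measurableT mf).
have iRN := Radon_Nikodym_SigmaFinite.f_integrable dom.
have mp := measurable_normal_pdf m s.
apply: ae_eq_integral => //.
- by apply: emeasurable_funM => //; exact: measurable_int iRN.
- by apply: emeasurable_funM => //; exact/measurable_EFinP.
- apply: ae_eqe_mul2l; apply: integral_ae_eq => //.
  + exact/measurable_EFinP.
  + move=> A _ mA.
    by rewrite -(Radon_Nikodym_SigmaFinite.f_integral dom).
Qed.

Context {d} {T : measurableType d} {P : probability T R}.

Lemma ge0_integral_law (Q : probability (measurableTypeR R) R) (X : T -> R) (f : R -> \bar R) :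
  measurable_fun setT (X : T -> measurableTypeR R) ->
  (forall A : set R, measurable A -> P (X @^-1` A) = Q A) ->
  measurable_fun setT f -> (forall x, (0 <= f x)%E) ->
  (\int[P]_w f (X w) = \int[Q]_x f x)%E.
Proof.
move=> mX XQ mf f0.
pose X' : {mfun T >-> measurableTypeR R} :=
  @mfun_Sub _ _ T (measurableTypeR R) X (mem_set mX).
rewrite -(@eq_measure_integral _ _ _ _ _ (pushforward P X')); last first.
  by move=> A mA _; exact: XQ.
by rewrite ge0_integral_pushforward.
Qed.

(** Only nonnegative functions are transported to the law of [X], so the first moment is hidden in
    the third identity: expanding its square yields [E (X - m) = 0]. *)
Lemma gaussian_rv_moments (X : T -> R) : measurable_fun setT X ->
  gaussian_rv P X -> exists m s : R,
  [/\ (\int[P]_w ((X w - m) ^+ 2)%:E = (s ^+ 2)%:E)%E,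
      (\int[P]_w ((X w - m) ^+ 4)%:E = (3 * s ^+ 4)%:E)%E &
      (\int[P]_w ((X w - m + 1) ^+ 2)%:E = (s ^+ 2 + 1)%:E)%E].
Proof.
move=> mX [m [s XQ]]; exists m, s; rewrite /gaussian_law in XQ.
have mpoly (c : R) k : measurable_fun setT (fun x : R => ((x - m + c) ^+ k)%:E).
  apply/measurable_EFinP/measurable_funX/measurable_funD => //.
  exact: measurable_funB.
have ge0 (c x : R) k : ~~ odd k -> (0 <= ((x - m + c) ^+ k)%:E)%E.
  by move=> k2; rewrite lee_fin exprn_even_ge0.
have X0 k : (\int[P]_w ((X w - m) ^+ k)%:E = \int[P]_w ((X w - m + 0) ^+ k)%:E)%E.
  by apply: eq_integral => w _; rewrite addr0.
have [s0|s0] := eqVneq s 0.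
  rewrite s0 eqxx in XQ *.
  have D (c : R) k : ~~ odd k ->
      (\int[P]_w ((X w - m + c) ^+ k)%:E = ((m - m + c) ^+ k)%:E)%E.
    move=> k2; rewrite (ge0_integral_law (@dirac _ (measurableTypeR R) m R : probability (measurableTypeR R) R) X _ mX XQ (mpoly c k))//.
      rewrite integral_dirac//; last exact: mpoly.
      by rewrite /= diracE in_setT mul1e.
    by move=> x; exact: ge0.
  by rewrite !X0 !D// subrr !add0r !expr0n expr1n /= mulr0 add0r.
rewrite (negbTE s0) in XQ.
have D (c : R) k : ~~ odd k ->
    (\int[P]_w ((X w - m + c) ^+ k)%:E =
     \int[mu]_x ((x - m + c) ^+ k * normal_pdf m s x)%:E)%E.
  move=> k2; rewrite (ge0_integral_law (normal_prob m s) X _ mX XQ (mpoly c k)).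
    by rewrite ge0_integral_normal_prob// => x; exact: ge0.
  by move=> x; exact: ge0.
have toR (f : R -> R) : mu.-integrable setT (EFin \o f) ->
    (\int[mu]_x (f x)%:E = (\int[mu]_x f x)%:E)%E.
  by move=> fi; rewrite fineK//; exact: integrable_fin_num.
have [M1 M2 M4] := normal_moments m s s0; have M0 := normal_moment0 m s.
have i0 := integrable_normal_moment m s 0 s0 isT.
have i1 := integrable_normal_moment m s 1 s0 isT.
have i2 := integrable_normal_moment m s 2 s0 isT.
have i4 := integrable_normal_moment m s 4 s0 isT.
split.
- rewrite -M2 -toR//; rewrite X0 D//.
  by apply: eq_integral => x _; rewrite addr0.
- rewrite -M4 -toR//; rewrite X0 D//.
  by apply: eq_integral => x _; rewrite addr0.
- rewrite (D 1 2%N isT).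
  pose g x : R := (x - m) ^+ 2 * normal_pdf m s x +
    (2 * ((x - m) ^+ 1 * normal_pdf m s x) + (x - m) ^+ 0 * normal_pdf m s x).
  have ig : mu.-integrable setT (EFin \o g).
    by do 2 apply: integrable_add => //; exact: integrable_scale.
  transitivity (\int[mu]_x (g x)%:E)%E.
    by apply: eq_integral => x _; congr EFin; rewrite /g; ring.
  rewrite toR// /g RintegralD//; last first.
    by apply: integrable_add => //; exact: integrable_scale.
  rewrite RintegralD//; last exact: integrable_scale.
  rewrite RintegralZl// M2 M1 mulr0 add0r.
  by under eq_Rintegral do rewrite expr0 mul1r; rewrite M0.
Qed.

Lemma integrable_of_integral (f : T -> R) (r : R) : measurable_fun setT f ->
  (forall w, 0 <= f w) -> (\int[P]_w (f w)%:E = r%:E)%E ->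
  P.-integrable setT (EFin \o f).
Proof.
move=> mf f0 fr; apply/integrableP; split; first exact/measurable_EFinP.
rewrite (eq_integral (EFin \o f)) ?fr ?ltry// => w _ /=.
by rewrite ger0_norm.
Qed.

Lemma integrable_cstP (c : R) : P.-integrable setT (EFin \o (fun=> c)).
Proof. exact: (finite_measure_integrable_cst P c). Qed.

Lemma Rintegral_cstP (c : R) : \int[P]_w c = c.
Proof.
have := @probability_setT _ T R P => P1.
by rewrite Rintegral_cst//= P1 mulr1.
Qed.

Lemma sqint_cst (c : R) : sqint P (fun=> c).
Proof. by split; [exact: measurable_cst | exact: integrable_cstP]. Qed.

Lemma sqint_integrable (f : T -> R) : sqint P f ->
  P.-integrable setT (EFin \o f).
Proof.
move=> hf; have := sqint_mul P _ _ hf (sqint_cst 1).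
by under eq_fun do rewrite mulr1.
Qed.

Lemma gaussian_rv_sqint (X : T -> R) : measurable_fun setT X ->
  gaussian_rv P X -> sqint P X.
Proof.
move=> mX /(gaussian_rv_moments _ mX)[m [s [h2 _ _]]].
have mXm : measurable_fun setT (fun w => X w - m) by exact: measurable_funB.
have : sqint P (fun w => X w - m).
  split=> //; apply: (integrable_of_integral _ _ _ _ h2); first exact: measurable_funX.
  by move=> w; exact: sqr_ge0.
by move=> /sqintD /(_ (sqint_cst m)); under eq_fun do rewrite subrK.
Qed.

Lemma gaussian_rv_moment4 (X : T -> R) : measurable_fun setT X ->
  gaussian_rv P X -> \int[P]_w X w = 0 ->
  P.-integrable setT (EFin \o (fun w => X w ^+ 4)) /\
  \int[P]_w (X w ^+ 4) = 3 * (\int[P]_w (X w ^+ 2)) ^+ 2.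
Proof.
move=> mX gX EX; have [m [s [h2 h4 h1]]] := gaussian_rv_moments _ mX gX.
have hX := gaussian_rv_sqint _ mX gX; have iX := sqint_integrable _ hX.
have hXm : sqint P (fun w => X w - m) := sqintB P _ _ hX (sqint_cst m).
(* Expanding [(X - m + 1) ^+ 2] forces [E (X - m) = 0], while [E X = 0]: the location parameter of
   the law is the mean. *)
have m0 : m = 0.
  move: h1; rewrite -[LHS]fineK; last first.
    apply: integrable_fin_num => //.
    by have [_] := sqintD P _ _ hXm (sqint_cst 1).
  move=> [] h1; have [_ i2] := hXm; have i1 := sqint_integrable _ hXm.
  have E2 : \int[P]_w ((X w - m) ^+ 2) = s ^+ 2 by rewrite /Rintegral h2.
  have E1 : \int[P]_w (X w - m) = - m.
    by rewrite RintegralB ?EX ?sub0r ?Rintegral_cstP//; exact: integrable_cstP.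
  have : \int[P]_w ((X w - m) ^+ 2 + (2 * (X w - m) + 1)) = s ^+ 2 + 1.
    by rewrite -h1; apply: eq_Rintegral => w _; ring.
  have i21 : P.-integrable setT (EFin \o (fun w => 2 * (X w - m))).
    exact: integrable_scale.
  rewrite RintegralD//; last exact: integrable_add _ (integrable_cstP 1).
  rewrite RintegralD//; last exact: integrable_cstP.
  by rewrite RintegralZl// E2 E1 Rintegral_cstP; lra.
rewrite m0 in h2 h4.
have {}h2 : (\int[P]_w (X w ^+ 2)%:E = (s ^+ 2)%:E)%E.
  by rewrite -h2; apply: eq_integral => w _; rewrite subr0.
have {}h4 : (\int[P]_w (X w ^+ 4)%:E = (3 * s ^+ 4)%:E)%E.
  by rewrite -h4; apply: eq_integral => w _; rewrite subr0.
split; last by rewrite /Rintegral h2 h4 /=; ring.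
apply: (integrable_of_integral _ _ _ _ h4); first exact: measurable_funX.
by move=> w; rewrite exprn_even_ge0.
Qed.

End gaussian_moments.

Section bilinear.
Context {d} {T : measurableType d} {R : realType}.
Variable mu : {measure set T -> \bar R}.

Lemma Rintegral_bilinear n m (a : 'I_n -> R) (b : 'I_m -> R)
    (f : 'I_n -> T -> R) (g : 'I_m -> T -> R) :
  (forall i, sqint mu (f i)) -> (forall j, sqint mu (g j)) ->
  \int[mu]_x ((\sum_i a i * f i x) * (\sum_j b j * g j x)) =
  \sum_i \sum_j a i * b j * \int[mu]_x (f i x * g j x).
Proof.
move=> hf hg.
have ifg i j : mu.-integrable setT (EFin \o (fun x => f i x * g j x)).
  exact: sqint_mul.
have iab i j : mu.-integrable setT
    (EFin \o (fun x => a i * b j * (f i x * g j x))).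
  exact: integrable_scale.
transitivity (\int[mu]_x (\sum_i \sum_j a i * b j * (f i x * g j x))).
  apply: eq_Rintegral => x _; rewrite mulr_suml; apply: eq_bigr => i _.
  by rewrite mulr_sumr; apply: eq_bigr => j _; ring.
rewrite Rintegral_bigsum => [|i]; last exact: integrable_bigsum.
apply: eq_bigr => i _; rewrite Rintegral_bigsum => [|j]; last exact: iab.
by apply: eq_bigr => j _; rewrite RintegralZl.
Qed.

End bilinear.

(** * Fourth-order moments of jointly Gaussian variables *)

Section gaussian_family.
Context {d} {T : measurableType d} {R : realType} {P : probability T R}.

Lemma gaussian_moment22 (X Y : T -> R) :
  measurable_fun setT X -> measurable_fun setT Y ->
  (forall a b, gaussian_rv P (fun w => a * X w + b * Y w)) ->
  \int[P]_w X w = 0 -> \int[P]_w Y w = 0 ->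
  P.-integrable setT (EFin \o (fun w => X w ^+ 2 * Y w ^+ 2)) /\
  \int[P]_w (X w ^+ 2 * Y w ^+ 2) =
  \int[P]_w (X w ^+ 2) * \int[P]_w (Y w ^+ 2) + 2 * (\int[P]_w (X w * Y w)) ^+ 2.
Proof.
move=> mX mY G EX EY.
have mL a b : measurable_fun setT (fun w => a * X w + b * Y w).
  by apply: measurable_funD; exact: measurable_funM.
have gX : gaussian_rv P X.
  by have := G 1 0; under eq_fun do rewrite mul1r mul0r addr0.
have gY : gaussian_rv P Y.
  by have := G 0 1; under eq_fun do rewrite mul1r mul0r add0r.
have hX := gaussian_rv_sqint _ mX gX; have hY := gaussian_rv_sqint _ mY gY.
have iX := sqint_integrable _ hX; have iY := sqint_integrable _ hY.
have iXY := sqint_mul _ _ _ hX hY.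
have iX2 : P.-integrable setT (EFin \o (fun w => X w ^+ 2)) by case: hX.
have iY2 : P.-integrable setT (EFin \o (fun w => Y w ^+ 2)) by case: hY.
pose x2 := \int[P]_w (X w ^+ 2); pose y2 := \int[P]_w (Y w ^+ 2).
pose xy := \int[P]_w (X w * Y w).
have M4 a b := gaussian_rv_moment4 _ (mL a b) (G a b).
have {}M4 a b : P.-integrable setT (EFin \o (fun w => (a * X w + b * Y w) ^+ 4)) /\
    \int[P]_w ((a * X w + b * Y w) ^+ 4) =
    3 * (a ^+ 2 * x2 + 2 * a * b * xy + b ^+ 2 * y2) ^+ 2.
  have [|i4 ->] := M4 a b.
    rewrite RintegralD//; try exact: integrable_scale.
    by rewrite !RintegralZl// EX EY !mulr0 addr0.
  split=> //; congr (3 * _ ^+ 2).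
  transitivity (\int[P]_w (a ^+ 2 * X w ^+ 2 +
      (2 * a * b * (X w * Y w) + b ^+ 2 * Y w ^+ 2))).
    by apply: eq_Rintegral => w _; ring.
  rewrite RintegralD//; last 2 first.
    exact: integrable_scale.
    by apply: integrable_add; exact: integrable_scale.
  by rewrite RintegralD//; try exact: integrable_scale;
    rewrite !RintegralZl// addrA.
have [ip Ep] := M4 1 1; have [im Em] := M4 1 (-1).
have [ix Ex] := M4 1 0; have [iy Ey] := M4 0 1.
(* Polarization: [(X + Y)^4 + (X - Y)^4 - 2 X^4 - 2 Y^4 = 12 X^2 Y^2]. The coefficients 0, 1, -1
   stay visible so that each term is an instance of [M4]. *)
pose A w := (1 * X w + 1 * Y w) ^+ 4 + (1 * X w + -1 * Y w) ^+ 4.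
pose B w := -2 * (1 * X w + 0 * Y w) ^+ 4 + -2 * (0 * X w + 1 * Y w) ^+ 4.
have iA : P.-integrable setT (EFin \o A) by exact: integrable_add.
have iB : P.-integrable setT (EFin \o B).
  by apply: integrable_add; exact: integrable_scale.
have E : (fun w => X w ^+ 2 * Y w ^+ 2) = (fun w => 12^-1 * (A w + B w)).
  by apply/funext => w; rewrite /A /B; field.
rewrite E; split; first exact/integrable_scale/integrable_add.
rewrite RintegralZl//; last exact: integrable_add.
rewrite RintegralD// /A /B RintegralD// RintegralD//; try exact: integrable_scale.
rewrite !RintegralZl// Ep Em Ex Ey -/x2 -/y2 -/xy.
by field.
Qed.

(** [v] is a free centring, not the variance of [S k]: at a finite stage of the approximation the
    two may differ, and the second summand is the resulting product of biases. *)
Lemma gaussian_avg_var n (S : 'I_n -> T -> R) (v : R) :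
  (forall k, measurable_fun setT (S k)) ->
  (forall k l a b, gaussian_rv P (fun w => a * S k w + b * S l w)) ->
  (forall k, \int[P]_w S k w = 0) ->
  sqint P (fun w => \sum_k (S k w ^+ 2 - v)) /\
  \int[P]_w ((\sum_k (S k w ^+ 2 - v)) ^+ 2) =
  \sum_k \sum_l (2 * (\int[P]_w (S k w * S l w)) ^+ 2 +
    (\int[P]_w (S k w ^+ 2) - v) * (\int[P]_w (S l w ^+ 2) - v)).
Proof.
move=> mS G ES.
have gS k : gaussian_rv P (S k).
  by have := G k k 1 0; under eq_fun do rewrite mul1r mul0r addr0.
have hS k := gaussian_rv_sqint _ (mS k) (gS k).
have hS2 k : sqint P (fun w => S k w ^+ 2).
  split; first exact: measurable_funX.
  have [+ _] := gaussian_rv_moment4 _ (mS k) (gS k) (ES k).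
  by congr (P.-integrable _ _); apply/funext => w /=; congr EFin; ring.
have hSv k : sqint P (fun w => S k w ^+ 2 - v).
  by apply: sqintB => //; exact: sqint_cst.
split; first exact: sqint_sum.
have := Rintegral_bilinear P n n (fun=> 1) (fun=> 1) _ _ hSv hSv.
under eq_Rintegral => w _.
  under eq_bigr do rewrite mul1r.
  rewrite -expr2; over.
move=> ->; apply: eq_bigr => k _; apply: eq_bigr => l _; rewrite !mul1r.
have [i22 E22] := gaussian_moment22 _ _ (mS k) (mS l) (G k l) (ES k) (ES l).
have i2 j : P.-integrable setT (EFin \o (fun w => S j w ^+ 2)).
  by have [_] := hS j.
transitivity (\int[P]_w (S k w ^+ 2 * S l w ^+ 2 +
   (- v * S k w ^+ 2 + (- v * S l w ^+ 2 + v ^+ 2)))).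
  by apply: eq_Rintegral => w _; ring.
have ic := integrable_cstP (P := P) (v ^+ 2).
have i3 : P.-integrable setT (EFin \o (fun w => - v * S l w ^+ 2 + v ^+ 2)).
  by apply: integrable_add => //; exact: integrable_scale.
have i4 : P.-integrable setT
    (EFin \o (fun w => - v * S k w ^+ 2 + (- v * S l w ^+ 2 + v ^+ 2))).
  by apply: integrable_add => //; exact: integrable_scale.
rewrite RintegralD// RintegralD//; last exact: integrable_scale.
rewrite RintegralD//; last exact: integrable_scale.
rewrite !RintegralZl//; last exact: integrable_cstP.
by rewrite E22 Rintegral_cstP; ring.
Qed.

End gaussian_family.

(** * Wiener integrals of step functions *)

Section wiener_step.
Context {d} {T : measurableType d} {R : realType} {P : probability T R}.
Variable W : R -> {RV P >-> R}.
Hypothesis hW : bilateral_wiener W.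
Local Notation mu := (@lebesgue_measure R).

(** The linear span of the values of [W], the class to which [gaussian_process] applies. It absorbs
    combinations of step integrals over unrelated grids. *)
Definition wiener_span (X : T -> R) := exists k (c t : 'I_k -> R),
  X = fun w => \sum_(i < k) c i * W (t i) w.

Lemma wiener_spanW t : wiener_span (W t).
Proof.
exists 1%N, (fun=> 1), (fun=> t); apply/funext => w.
by rewrite big_ord1 mul1r.
Qed.

Lemma wiener_spanD X Y : wiener_span X -> wiener_span Y ->
  wiener_span (fun w => X w + Y w).
Proof.
move=> [k [c [t ->]]] [k' [c' [t' ->]]]; exists (k + k')%N.
exists (fun i : 'I_(k + k') => match fintype.split i with inl i => c i | inr i => c' i end).
exists (fun i : 'I_(k + k') => match fintype.split i with inl i => t i | inr i => t' i end).
apply/funext => w; rewrite big_split_ord /=; congr (_ + _);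
  apply: eq_bigr => i _.
- by rewrite (unsplitK (inl i)).
- by rewrite (unsplitK (inr i)).
Qed.

Lemma wiener_spanZ a X : wiener_span X -> wiener_span (fun w => a * X w).
Proof.
move=> [k [c [t ->]]]; exists k, (fun i => a * c i), t.
by apply/funext => w; rewrite mulr_sumr; apply: eq_bigr => i _; rewrite mulrA.
Qed.

Lemma wiener_span_sum k (F : 'I_k -> T -> R) : (forall i, wiener_span (F i)) ->
  wiener_span (fun w => \sum_i F i w).
Proof.
elim: k F => [F _|k IH F hF].
  exists 0%N, (fun=> 0), (fun=> 0).
  by apply/funext => w; rewrite !big_ord0.
under eq_fun do rewrite big_ord_recl.
by apply: wiener_spanD => //; exact: IH.
Qed.

Lemma wiener_span_gaussian X : wiener_span X -> gaussian_rv P X.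
Proof. by move=> [k [c [t ->]]]; exact: wiener_gaussian. Qed.

Lemma wiener_sqint t : sqint P (W t).
Proof. exact/gaussian_rv_sqint/wiener_span_gaussian/wiener_spanW. Qed.

Lemma wiener_span_sqint X : wiener_span X -> sqint P X.
Proof.
by move=> [k [c [t ->]]]; apply: sqint_sum => i; exact/sqintZ/wiener_sqint.
Qed.

Lemma wiener_Rmean t : \int[P]_w W t w = 0.
Proof. by have := wiener_mean hW t; rewrite unlock /Rintegral => ->. Qed.

Lemma wiener_span_mean X : wiener_span X -> \int[P]_w X w = 0.
Proof.
move=> [k [c [t ->]]].
have iW i := sqint_integrable _ (wiener_sqint (t i)).
rewrite Rintegral_bigsum => [|i]; last exact/integrable_scale.
by rewrite big1// => i _; rewrite RintegralZl// wiener_Rmean mulr0.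
Qed.

Lemma wiener_Rcov s t :
  \int[P]_w (W s w * W t w) = (`|s| + `|t| - `|t - s|) / 2.
Proof.
have := wiener_cov hW s t; rewrite unlock !(wiener_mean hW) unlock /= => E.
rewrite /Rintegral; transitivity (fine ((`|s| + `|t| - `|t - s|) / 2)%:E) => //.
rewrite -E; congr fine; apply: eq_integral => w _.
by rewrite mulrfctE /= !subr0.
Qed.

(** The right-hand side is the length of the overlap of []a, b]] and []a', b']]. In the bilinear
    expansion the terms [|s|] cancel, so the position of the origin is irrelevant and only four
    distances remain, compared case by case. *)
Lemma wiener_increment_cov a b a' b' : a <= b -> a' <= b' ->
  \int[P]_w ((W b w - W a w) * (W b' w - W a' w)) =
  Num.max 0 (Num.min b b' - Num.max a a').
Proof.
move=> ab ab'.
have i s t : P.-integrable setT (EFin \o (fun w => W s w * W t w)).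
  exact/sqint_mul/wiener_sqint/wiener_sqint.
have iN s t : P.-integrable setT (EFin \o (fun w => -1 * (W s w * W t w))).
  exact: integrable_scale.
transitivity (\int[P]_w ((W b w * W b' w + W a w * W a' w) +
    (-1 * (W b w * W a' w) + -1 * (W a w * W b' w)))).
  by apply: eq_Rintegral => w _; ring.
rewrite RintegralD//; [|exact: integrable_add|exact: integrable_add].
rewrite RintegralD// RintegralD// !RintegralZl// !wiener_Rcov.
have ge0 (x : R) : 0 <= x -> `|x| = x by exact: ger0_norm.
have le0 (x : R) : x <= 0 -> `|x| = - x by exact: ler0_norm.
have [bb|bb] := lerP b b'; have [aa|aa] := lerP a a';
have [b'a|b'a] := lerP a' b; have [ba'|ba'] := lerP a b';
  rewrite ?(ge0 (b' - b)) ?(le0 (b' - b)) ?(ge0 (a' - a)) ?(le0 (a' - a))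
    ?(ge0 (a' - b)) ?(le0 (a' - b)) ?(ge0 (b' - a)) ?(le0 (b' - a)); try lra;
  match goal with |- context [Num.max 0 ?x] => have [h|h] := lerP 0 x end; lra.
Qed.

Lemma indic_itv_sqint (a b : R) : sqint mu (\1_(`]a, b]) : R -> R).
Proof.
split; first exact: measurable_indic.
rewrite (_ : (fun x => _) = \1_(`]a, b])).
  exact: (integrable_indic_itv a b false false).
by apply/funext => x; rewrite indicE; case: (_ \in _); rewrite ?expr1n ?expr0n.
Qed.

Lemma Rintegral_indic_itv_mul a b a' b' : a <= b -> a' <= b' ->
  \int[mu]_x ((\1_(`]a, b]) x : R) * \1_(`]a', b']) x) =
  Num.max 0 (Num.min b b' - Num.max a a').
Proof.
move=> ab ab'; rewrite /Rintegral.
rewrite (_ : (fun x => _) = (fun x =>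
  (\1_(`](Num.max a a'), (Num.min b b')]) x)%:E)); last first.
  apply/funext => x; congr EFin; rewrite !indicE -natrM mulnb; congr ((_ : bool)%:R).
  rewrite !mem_setE !in_itv /= gt_max le_min.
  by case: (a < x); case: (a' < x); case: (x <= b).
rewrite integral_indic//= setIT lebesgue_measure_itv/= lte_fin.
case: ltP => h; first by rewrite -EFinB /= [RHS]max_r// subr_ge0 ltW.
by rewrite [RHS]max_l// subr_le0.
Qed.

Lemma step_integral_span (s : step R) : wiener_span (step_integral W s).
Proof.
apply: wiener_span_sum => i; apply: wiener_spanZ.
under eq_fun do rewrite -mulN1r.
by apply: wiener_spanD; [|apply: wiener_spanZ]; exact: wiener_spanW.
Qed.

Lemma step_fun_sqint (s : step R) : sqint mu (step_fun s).
Proof. by apply: sqint_sum => i; exact/sqintZ/indic_itv_sqint. Qed.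

(** Wiener isometry in polarized form. No common refinement of the two grids is formed: bilinearity
    reduces the claim to pairs of intervals, where both sides are the length of the overlap. *)
Lemma step_isometry (s s' : step R) :
  \int[P]_w (step_integral W s w * step_integral W s' w) =
  \int[mu]_x (step_fun s x * step_fun s' x).
Proof.
rewrite (Rintegral_bilinear P _ _ _ _
  (fun i w => W (step_node s i.+1) w - W (step_node s i) w)
  (fun i w => W (step_node s' i.+1) w - W (step_node s' i) w)); last 2 first.
  by move=> i; apply: sqintB; exact: wiener_sqint.
  by move=> i; apply: sqintB; exact: wiener_sqint.
rewrite (Rintegral_bilinear mu _ _ _ _
  (fun i x => \1_(`]step_node s i, step_node s i.+1]) x)
  (fun i x => \1_(`]step_node s' i, step_node s' i.+1]) x)); last 2 first.
  by move=> i; exact: indic_itv_sqint.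
  by move=> i; exact: indic_itv_sqint.
apply: eq_bigr => i _; apply: eq_bigr => j _.
by rewrite wiener_increment_cov ?Rintegral_indic_itv_mul//;
  exact: step_node_nondecreasing.
Qed.

End wiener_step.

(** * Covariance of the Ornstein-Uhlenbeck process *)

Section ou_kernel.
Context {R : realType}.
Local Notation mu := (@lebesgue_measure R).

Lemma integral_expR_tail (a m : R) : 0 < a ->
  (\int[mu]_(x in `]-oo, m]) (expR (- a * (m - x)))%:E = (a^-1)%:E)%E.
Proof.
move=> a0.
(* [c = -1] is the given integrand, [c = 1] its reflection about 0. *)
have cE (c : R) : continuous (fun x => expR (- a * (m + c * x))).
  move=> x; apply: (@continuous_comp _ _ _ (fun x => - a * (m + c * x)) expR).
    by apply: cvgM; [exact: cvg_cst | apply: cvgD; [exact: cvg_cst |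
      apply: cvgM; [exact: cvg_cst | exact: cvg_id]]].
  exact: continuous_expR.
have dF (x : R) : is_derive x (1 : R)
    (fun x : R => - a^-1 * expR (- a * (m + 1 * x))) (expR (- a * (m + 1 * x))).
  have d1 : is_derive x (1 : R) (fun x : R => - a * (m + 1 * x)) (- a).
    by apply: is_derive_eq; rewrite /GRing.scale /=; ring.
  have d2 : is_derive x (1 : R) (fun x : R => expR (- a * (m + 1 * x)))
      (- a * expR (- a * (m + 1 * x))).
    by apply: (is_derive_eq (is_derive1_comp _ _)); rewrite mulrC.
  apply: is_derive_eq; rewrite /GRing.scale /=.
  by field; rewrite gt_eqF.
(* Reflection turns the domain into [[-m, +oo[], where the primitive tends to 0 at infinity and
   equals [- a^-1] at [-m]. *)
rewrite -[X in `]-oo, X]%classic]opprK ge0_integration_by_substitutionNy; last 2 first.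
- apply: continuous_subspaceT.
  by have := cE (-1); under eq_fun do rewrite mulN1r.
- by move=> x _; exact: expR_ge0.
rewrite (@ge0_continuous_FTC2y _ _ (fun x => - a^-1 * expR (- a * (m + 1 * x))) _ 0).
- by rewrite mul1r subrr mulr0 expR0 mulr1 EFinN oppeK add0e.
- by move=> x _; exact: expR_ge0.
- apply: continuous_subspaceT.
  rewrite (_ : _ \o _ = fun x => expR (- a * (m + 1 * x))); first exact: cE.
  by apply/funext => x /=; rewrite mul1r opprK.
- rewrite -[0](mulr0 (- a^-1)); apply: cvgM; first exact: cvg_cst.
  have lin : (a * (m + 1 * x)) @[x --> +oo] --> +oo.
    apply/cvgryPge => A; near=> x.
    rewrite mul1r mulrC -ler_pdivrMr// -lerBlDl; near: x.
    by apply: nbhs_pinfty_ge; rewrite num_real.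
  have := cvg_comp _ _ lin (@cvgr_expR R); apply: cvg_trans.
  by under eq_cvg do rewrite mulNr.
- by move=> x _; have := dF x; case.
- apply: cvg_at_right_filter; apply: cvgM; first exact: cvg_cst.
  exact: cE.
- by move=> x _; rewrite derive1E; rewrite derive_val /= mul1r opprK.
Unshelve. all: by end_near. Qed.
Lemma cvg_sum_fun n (f : 'I_n -> nat -> R) (l : 'I_n -> R) :
  (forall i, f i @ \oo --> l i) ->
  (\sum_i f i m) @[m --> \oo] --> \sum_i l i.
Proof.
by move=> fl; apply: cvg_big => // ; exact: add_continuous.
Qed.

Definition ou_kernel (theta t x : R) : R :=
  \1_(`]-oo, t]) x * expR (- theta * (t - x)).

(** Because [s + t = |t - s| + 2 min(s, t)]: the product is a constant times a single one-sided
    exponential of rate [2 * theta]. *)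
Lemma ou_kernel_mul theta s t x : ou_kernel theta s x * ou_kernel theta t x =
  expR (- theta * `|t - s|) *
  (\1_(`]-oo, (Num.min s t)]) x * expR (- (2 * theta) * (Num.min s t - x))).
Proof.
rewrite /ou_kernel mulrACA [RHS]mulrCA; congr (_ * _).
  rewrite !indicE -natrM mulnb; congr ((_ : bool)%:R).
  by rewrite !mem_setE !in_itv /= le_min.
rewrite -!expRD; congr expR.
by case: (lerP s t) => st; ring.
Qed.

Let integral_ou_kernel_mul theta s t : 0 < theta ->
  (\int[mu]_x (ou_kernel theta s x * ou_kernel theta t x)%:E =
   (expR (- theta * `|t - s|) / (2 * theta))%:E)%E.
Proof.
move=> theta0; set m := Num.min s t.
transitivity (\int[mu]_(x in `]-oo, m]) ((expR (- theta * `|t - s|))%:E *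
   (expR (- (2 * theta) * (m - x)))%:E))%E.
  rewrite [RHS]integral_mkcond; apply: eq_integral => x _.
  rewrite ou_kernel_mul patchE indicE; case: ifPn => _.
    by rewrite mul1r EFinM.
  by rewrite mul0r mulr0.
rewrite ge0_integralZl//.
- by rewrite integral_expR_tail ?EFinM// mulr_gt0.
- apply/measurable_EFinP/measurable_funTS; apply: measurableT_comp => //.
  by apply: measurable_funM => //; exact: measurable_funB.
Qed.

Lemma ou_kernel_measurable theta t : measurable_fun setT (ou_kernel theta t).
Proof.
apply: measurable_funM; first exact: measurable_indic.
apply: measurableT_comp => //.
by apply: measurable_funM => //; exact: measurable_funB.
Qed.

Lemma ou_kernel_sqint theta t : 0 < theta -> sqint mu (ou_kernel theta t).
Proof.
move=> theta0; split; first exact: ou_kernel_measurable.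
have := integral_ou_kernel_mul theta t t theta0 => E.
apply/integrableP; split.
  apply/measurable_EFinP; apply: measurable_funX.
  exact: (ou_kernel_measurable theta t).
rewrite [ltLHS](_ : _ =
    (\int[mu]_x (ou_kernel theta t x * ou_kernel theta t x)%:E)%E).
  by rewrite E ltry.
by apply: eq_integral => x _; rewrite /= ger0_norm ?sqr_ge0// expr2.
Qed.

Lemma Rintegral_ou_kernel_mul theta s t : 0 < theta ->
  \int[mu]_x (ou_kernel theta s x * ou_kernel theta t x) =
  expR (- theta * `|t - s|) / (2 * theta).
Proof. by move=> theta0; rewrite /Rintegral integral_ou_kernel_mul. Qed.

End ou_kernel.

(** * Second moments of the process and L^1 bound for sums of centred squares *)

Section ou_covariance.
Context {d} {T : measurableType d} {R : realType} {P : probability T R}.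
Variables (W xi : R -> {RV P >-> R}) (theta : R).
Hypotheses (theta0 : 0 < theta) (hW : bilateral_wiener W)
  (hxi : ornstein_uhlenbeck W theta xi).
Local Notation mu := (@lebesgue_measure R).

(** Passage from extended-real to real convergence. As the limit is 0, the L^2 distance is finite
    from some index on, which makes [xi t] square-integrable. *)
Lemma ou_approx t : exists S : nat -> step R,
  [/\ \int[mu]_x ((ou_kernel theta t x - step_fun (S n) x) ^+ 2)
        @[n --> \oo] --> (0 : R),
      \int[P]_w ((xi t w - step_integral W (S n) w) ^+ 2)
        @[n --> \oo] --> (0 : R) &
      sqint P (xi t)].
Proof.
have [S [cf cE]] := ou_integral hxi t; exists S.
rewrite unlock in cE; split; [exact: fine_cvg cf | exact: fine_cvg cE | ].
have [n _ /(_ n (leqnn n)) fin] := cvg_is_fine cE.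
apply: (sqint_closeness P _ (step_integral W (S n))) => //.
  exact/(wiener_span_sqint _ hW)/step_integral_span.
by move: fin; rewrite ge0_fin_numE//; apply: integral_ge0 => w _;
  rewrite lee_fin sqr_ge0.
Qed.

Definition ou_step t : nat -> step R := sval (cid (ou_approx t)).

Lemma ou_stepP t :
  [/\ \int[mu]_x ((ou_kernel theta t x - step_fun (ou_step t n) x) ^+ 2)
        @[n --> \oo] --> (0 : R),
      \int[P]_w ((xi t w - step_integral W (ou_step t n) w) ^+ 2)
        @[n --> \oo] --> (0 : R) &
      sqint P (xi t)].
Proof. by rewrite /ou_step; case: (cid _). Qed.

Lemma ou_sqint t : sqint P (xi t).
Proof. by case: (ou_stepP t). Qed.

Lemma step_integral_sqint s : sqint P (step_integral W s).
Proof. exact/(wiener_span_sqint _ hW)/step_integral_span. Qed.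

Lemma cvg_ou_step_cov s t :
  \int[P]_w (step_integral W (ou_step s n) w * step_integral W (ou_step t n) w)
    @[n --> \oo] --> expR (- theta * `|t - s|) / (2 * theta).
Proof.
have [cs _ _] := ou_stepP s; have [ct _ _] := ou_stepP t.
rewrite -Rintegral_ou_kernel_mul//; under eq_cvg do rewrite (step_isometry _ hW).
apply: cvg_Rintegral_mul => //; try exact: ou_kernel_sqint.
- by move=> n; exact: step_fun_sqint.
- by move=> n; exact: step_fun_sqint.
Qed.

(** The second moments of the step integrals have two limits: [E xi_t^2] by L^2(P) convergence, and
    [v] by the isometry. Uniqueness of limits identifies them. *)
Lemma ou_moment2 t : \int[P]_w (xi t w ^+ 2) = (2 * theta)^-1.
Proof.
have [_ ct ht] := ou_stepP t; have hS n := step_integral_sqint (ou_step t n).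
have /(@cvg_unique _ (@Rhausdorff R)) := cvg_ou_step_cov t t.
rewrite subrr normr0 mulr0 expR0 mul1r; move=> /(_ (\int[P]_w (xi t w ^+ 2))) -> //.
by under eq_Rintegral do rewrite expr2; exact: cvg_Rintegral_mul.
Qed.

(** At stage m the left side is at most [D m], the L^1 cost of replacing [xi] by step integrals,
    plus a bound through the variance [V m]. The left side is independent of m, so the limit may be
    taken; the sum on the right is the limit of [V m]. *)
Lemma ou_avg_dist n (t : 'I_n -> R) dl : 0 < dl ->
  \int[P]_w `|\sum_k (xi (t k) w ^+ 2 - (2 * theta)^-1)| <=
  dl + dl^-1 * \sum_k \sum_l
    (2 * (expR (- theta * `|t l - t k|) / (2 * theta)) ^+ 2).
Proof.
move=> dl0; set v := (2 * theta)^-1.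
pose S k m := step_integral W (ou_step (t k) m).
have hS k m : sqint P (S k m) by exact: step_integral_sqint.
have spS k m : wiener_span W (S k m) by exact: step_integral_span.
have ix k : P.-integrable setT (EFin \o (fun w => xi (t k) w ^+ 2)).
  by case: (ou_sqint (t k)).
have iS k m : P.-integrable setT (EFin \o (fun w => S k m w ^+ 2)).
  by case: (hS k m).
pose V m := \sum_k \sum_l (2 * (\int[P]_w (S k m w * S l m w)) ^+ 2 +
    (\int[P]_w (S k m w ^+ 2) - v) * (\int[P]_w (S l m w ^+ 2) - v)).
pose D m := \sum_k \int[P]_w `|S k m w ^+ 2 - xi (t k) w ^+ 2|.
have le_m m : \int[P]_w `|\sum_k (xi (t k) w ^+ 2 - v)| <=
    D m + (dl + dl^-1 * V m).
  have [] := @gaussian_avg_var _ _ _ P n (fun k => S k m) v.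
  - by move=> k; case: (hS k m).
  - move=> k l a b; apply: (wiener_span_gaussian _ hW).
    by apply: wiener_spanD; exact: wiener_spanZ.
  - by move=> k; exact: (wiener_span_mean _ hW).
  move=> hV EV; rewrite /V -EV /D.
  have i1 k : P.-integrable setT
      (EFin \o (fun w => `|S k m w ^+ 2 - xi (t k) w ^+ 2|)).
    by apply: integrable_norm; exact: (integrableB measurableT (iS k m) (ix k)).
  have idl : P.-integrable setT (EFin \o (fun=> dl)) by exact: integrable_cstP.
  have [_ iV] := hV; have := integrable_scale P dl^-1 _ iV => idV.
  rewrite -Rintegral_bigsum// -RintegralZl// -[X in _ + (X + _)](Rintegral_cstP (P := P)).
  rewrite -RintegralD// -RintegralD//; last 2 first.
  - exact: integrable_bigsum.
  - exact: integrable_add.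
  apply: le_Rintegral => //.
  - apply: integrable_norm; apply: (integrable_bigsum P _ (fun k w => xi (t k) w ^+ 2 - v)) => k.
    exact: (integrableB measurableT (ix k) (integrable_cstP v)).
  - by apply: integrable_add; [exact: integrable_bigsum | exact: integrable_add].
  move=> w _.
  have -> : \sum_k (xi (t k) w ^+ 2 - v) =
      \sum_k (S k m w ^+ 2 - v) - \sum_k (S k m w ^+ 2 - xi (t k) w ^+ 2).
    by rewrite -sumrB; apply: eq_bigr => k _; ring.
  set z := \sum_k (S k m w ^+ 2 - v).
  have h1 := ler_norm_sum (index_enum _) (fun k => S k m w ^+ 2 - xi (t k) w ^+ 2) xpredT.
  have h2 := ler_normB z (\sum_k (S k m w ^+ 2 - xi (t k) w ^+ 2)).
  (* Either [|z| <= dl], or [|z| / dl >= 1] and the quadratic term alone dominates. *)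
  suff : `|z| <= dl + dl^-1 * z ^+ 2 by lra.
  have dli : 0 < dl^-1 by rewrite invr_gt0.
  have -> : z ^+ 2 = `|z| ^+ 2 by rewrite real_normK ?num_real.
  have [zd|/ltW zd] := leP `|z| dl; first by rewrite ler_wpDr// mulr_ge0// ?sqr_ge0 ?ltW.
  have : 1 <= dl^-1 * `|z| by rewrite mulrC ler_pdivlMr// mul1r.
  by have := normr_ge0 z; nra.
have cD : D m @[m --> \oo] --> (0 : R).
  rewrite -[0](big1_eq (R := R) (op := +%R) (idx := 0) (index_enum 'I_n) xpredT).
  apply: cvg_sum_fun => k; have [_ ck hk] := ou_stepP (t k).
  have := @cvg_Rintegral_norm_mul _ _ _ P _ _ (S k) (S k) hk hk (hS k) (hS k) ck ck.
  by under eq_cvg do under eq_Rintegral do rewrite -!expr2.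
have cV : V m @[m --> \oo] --> \sum_k \sum_l
    (2 * (expR (- theta * `|t l - t k|) / (2 * theta)) ^+ 2).
  apply: cvg_sum_fun => k; apply: cvg_sum_fun => l.
  have cv j : (\int[P]_w (S j m w ^+ 2) - v) @[m --> \oo] --> (0 : R).
    rewrite -(subrr v); apply: cvgB; last exact: cvg_cst.
    have := cvg_ou_step_cov (t j) (t j).
    rewrite subrr normr0 mulr0 expR0 mul1r.
    by under eq_cvg do under eq_Rintegral do rewrite -!expr2.
  (* [0 * 0] stands for the limit of the product of the two biases [E S_k^2 - v] and
     [E S_l^2 - v]. *)
  set r := expR _ / _; have -> : 2 * r ^+ 2 = 2 * (r * r) + 0 * 0 by ring.
  apply: cvgD; last exact: cvgM.
  apply: cvgM; first exact: cvg_cst.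
  by under eq_cvg do rewrite expr2; apply: cvgM; exact: cvg_ou_step_cov.
set rhs := (X in _ <= X).
suff : D m + (dl + dl^-1 * V m) @[m --> \oo] --> rhs.
  by move=> /cvgr_to_ge; apply; exact: nearW.
rewrite /rhs -[dl + _]add0r; apply: cvgD => //; apply: cvgD; first exact: cvg_cst.
by apply: cvgM => //; exact: cvg_cst.
Qed.

End ou_covariance.

(** * Summability of squared covariances along the grid *)

Section geometric_distance.
Context {R : realType}.

(** With truncated subtraction, [(k - l) + (l - k)] is [|k - l|]. The bound depends on neither n nor
    k, so summing it over k gives O(n). *)
Lemma geometric_distn_sum (q : R) n k : 0 < q -> q < 1 ->
  \sum_(l < n) q ^+ ((k - l) + (l - k))%N <= 2 / (1 - q).
Proof.
move=> q0 q1; have q1' : 0 < 1 - q by rewrite subr_gt0.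
(* The bounds for [below] and [above] are the exact partial geometric sums or larger, shaped so that
   a new term is absorbed through [q^(j+1) + q^j (1 - q) = q^j]. *)
have below m : \sum_(l < m) (if (l <= k)%N then q ^+ (k - l) else 0) <=
    q ^+ (k.+1 - m) / (1 - q).
  elim: m => [|m IH]; first by rewrite big_ord0 divr_ge0 ?exprn_ge0// ltW.
  rewrite big_ord_recr /=; case: leqP => mk.
    apply: le_trans (lerD IH (lexx _)) _.
    by rewrite subSS subSn// exprS ler_pdivlMr// mulrDl divfK ?gt_eqF//; lra.
  move: IH; rewrite addr0 subSS.
  by have [/eqP -> /eqP ->] : (k.+1 - m == 0)%N /\ (k - m == 0)%N by rewrite !subn_eq0 mk ltnW.
have above m : \sum_(l < m) (if (k <= l)%N then q ^+ (l - k) else 0) <=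
    (1 - q ^+ (m - k)) / (1 - q).
  elim: m => [|m IH]; first by rewrite big_ord0 sub0n expr0 subrr mul0r.
  rewrite big_ord_recr /=; case: leqP => mk.
    apply: le_trans (lerD IH (lexx _)) _.
    by rewrite subSn// exprS ler_pdivlMr// mulrDl divfK ?gt_eqF//; lra.
  move: IH; rewrite addr0.
  by have [/eqP -> /eqP ->] : (m - k == 0)%N /\ (m.+1 - k == 0)%N by rewrite !subn_eq0 mk ltnW.
(* The diagonal [l = k] is counted in both halves, which only enlarges the sum. *)
apply: le_trans (_ : _ <= \sum_(l < n) ((if (l <= k)%N then q ^+ (k - l) else 0)
    + (if (k <= l)%N then q ^+ (l - k) else 0))) _.
  apply: ler_sum => l _; have [lk|kl] := leqP l k.
    have /eqP -> : (l - k == 0)%N by rewrite subn_eq0.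
    by rewrite addn0 lerDl; case: ifP => // _; rewrite exprn_ge0// ltW.
  have /eqP -> : (k - l == 0)%N by rewrite subn_eq0 ltnW.
  by rewrite ltnW// add0n add0r.
rewrite big_split /=; apply: le_trans (lerD (below n) (above n)) _.
rewrite -mulrDl ler_pM2r ?invr_gt0//.
have := exprn_ile1 (k.+1 - n) (ltW q0) (ltW q1).
have := exprn_ge0 (n - k) (ltW q0); lra.
Qed.

End geometric_distance.

Section ou_grid.
Context {d} {T : measurableType d} {R : realType} {P : probability T R}.
Variables (W xi : R -> {RV P >-> R}) (theta h : R).
Hypotheses (theta0 : 0 < theta) (h0 : 0 < h) (hW : bilateral_wiener W)
  (hxi : ornstein_uhlenbeck W theta xi).

(** [C] serves all offsets [u] at once, since the covariance sees only differences of times, in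
    which [u] cancels. *)
Lemma ou_grid_avg_dist : exists C : R, 0 < C /\ forall n u dl, 0 < dl ->
  \int[P]_w `|\sum_(k < n) (xi (k%:R * h + u) w ^+ 2 - (2 * theta)^-1)| <=
  dl + dl^-1 * (C * n%:R).
Proof.
(* [q ^+ |k - l|] is the square of the correlation at lag [|k - l| h], whence the factor 2. *)
pose q := expR (- (2 * theta * h)); set v := (2 * theta)^-1.
have v0 : 0 < v by rewrite invr_gt0 mulr_gt0.
have q0 : 0 < q by exact: expR_gt0.
have q1 : q < 1 by rewrite expR_lt1 oppr_lt0 !mulr_gt0.
have q1' : 0 < 1 - q by rewrite subr_gt0.
exists (2 * v ^+ 2 * (2 / (1 - q))); split.
  by apply: mulr_gt0; [rewrite mulr_gt0 ?exprn_gt0 | rewrite divr_gt0].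
move=> n u dl dl0.
apply: le_trans (ou_avg_dist _ _ _ theta0 hW hxi n (fun k => k%:R * h + u) dl dl0) _.
rewrite lerD2l ler_pM2l ?invr_gt0//.
have dist (k l : 'I_n) : `|l%:R * h + u - (k%:R * h + u)| =
    ((k - l) + (l - k))%N%:R * h.
  have -> : l%:R * h + u - (k%:R * h + u) = (l%:R - k%:R) * h by ring.
  rewrite normrM (gtr0_norm h0); congr (_ * _).
  have [lk|/ltnW kl] := leqP l k.
    have /eqP -> : (l - k == 0)%N by rewrite subn_eq0.
    by rewrite distrC -natrB// normr_nat addn0.
  have /eqP -> : (k - l == 0)%N by rewrite subn_eq0.
  by rewrite -natrB// normr_nat.
have term (k l : 'I_n) :
    2 * (expR (- theta * `|l%:R * h + u - (k%:R * h + u)|) / (2 * theta)) ^+ 2 =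
    2 * v ^+ 2 * q ^+ ((k - l) + (l - k))%N.
  rewrite dist /q -expRM_natl exprMn -/v -expRM_natl.
  rewrite [2 * (_ * _)]mulrCA mulrC; congr (_ * expR _).
  by ring.
apply: le_trans (_ : _ <= \sum_(k < n) 2 * v ^+ 2 * (2 / (1 - q))) _.
  apply: ler_sum => k _; under eq_bigr do rewrite term.
  rewrite -mulr_sumr ler_pM2l ?mulr_gt0 ?exprn_gt0//.
  exact: geometric_distn_sum.
by rewrite sumr_const card_ord mulr_natr.
Qed.


End ou_grid.

(** * Continuous processes and Tonelli *)

Section joint_measurability.
Context {d} {T : measurableType d} {R : realType}.
Implicit Type X : R -> T -> R.

(** Rounding time down to the grid of mesh [1 / (m + 1)] leaves countably many values, so preimages
    are countable unions of measurable rectangles; path continuity gives the pointwise limit in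
    m. *)
Lemma measurable_joint X : (forall t, measurable_fun setT (X t)) ->
  (forall w, continuous (X ^~ w)) ->
  measurable_fun setT (fun z : R * T => X z.1 z.2).
Proof.
move=> mX cX.
pose g (m : nat) (t : R) : R := (Num.floor (m.+1%:R * t))%:~R / m.+1%:R.
have gdist m t : `|t - g m t| <= m.+1%:R^-1.
  have m0 : (0 : R) < m.+1%:R by [].
  have /andP[f1 f2] := floor_itv (m.+1%:R * t).
  have -> : t - g m t = (m.+1%:R * t - (Num.floor (m.+1%:R * t))%:~R) / m.+1%:R.
    by rewrite mulrBl mulrC mulrA mulVf ?mul1r ?gt_eqF.
  rewrite ger0_norm; last by rewrite divr_ge0// subr_ge0.
  rewrite ler_piMl ?invr_ge0// lerBlDr.
  by rewrite intrD in f2; rewrite addrC ltW.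
apply: (@measurable_fun_cvg _ _ _ _ (fun m z => X (g m z.1) z.2)).
  move=> m _ Y mY; rewrite setTI.
  rewrite [X in measurable X](_ : _ = \bigcup_(k : int)
     ([set t | Num.floor (m.+1%:R * t) = k] `*` (X (k%:~R / m.+1%:R) @^-1` Y))); last first.
    apply/seteqP; split => [[t w] /= XY|[t w] [k _ [/= <-]]//].
    by exists (Num.floor (m.+1%:R * t)).
  apply: countable_bigcupT_measurable; first exact: countableP.
  move=> k; apply: measurableX; last first.
    by rewrite -[_ @^-1` _]setTI; exact: mX.
  rewrite [X in measurable X](_ : _ = (fun t => m.+1%:R * t) @^-1` `[k%:~R, (k + 1)%:~R[).
    rewrite -[_ @^-1` _]setTI.
    have : measurable_fun setT (fun t : R => m.+1%:R * t).
      exact: measurable_funM.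
    by apply => //; exact: measurable_itv.
  apply/seteqP; split => t /=; rewrite in_itv /=.
    by move=> <-; exact: floor_itv.
  exact: floor_def.
move=> [t w] _ /=.
apply: (@cvg_comp _ _ _ (fun m => g m t) (X ^~ w) _ (nbhs t)); last exact: cX.
apply/cvgrPdist_le => e e0; near=> m.
apply: le_trans (gdist m t) _; rewrite -(invrK e) lef_pV2 ?posrE ?invr_gt0//.
apply: le_trans (_ : _ <= m%:R) _; last by rewrite ler_nat.
by near: m; exact: nbhs_infty_ger.
Unshelve. all: by end_near. Qed.

Section tonelli_interval.
Variables (P : probability T R) (a b : R) (G : R * T -> R).
Hypotheses (mG : measurable_fun setT G) (G0 : forall z, 0 <= G z).
Local Notation mu := (@lebesgue_measure R).

(** The interval enters as an indicator, so that Tonelli can be applied on the full product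
    space. *)
Let f (z : measurableTypeR R * T) : \bar R := (G z * \1_(`[a, b]) z.1)%:E.

Let mf : measurable_fun setT f.
Proof.
apply/measurable_EFinP; apply: measurable_funM; first exact: mG.
have m1 : measurable_fun setT (\1_(`[a, b]) : R -> R) by exact: measurable_indic.
exact: (measurableT_comp m1 measurable_fst).
Qed.

Let f0 z : (0 <= f z)%E.
Proof. by rewrite lee_fin mulr_ge0. Qed.

Let fE w : (\int[mu]_(u in `[a, b]) (G (u, w))%:E)%E = fubini_G mu f w.
Proof.
rewrite /fubini_G [LHS]integral_mkcond; apply: eq_integral => u _.
by rewrite patchE /f indicE /=; case: ifP => _; rewrite ?mulr1 ?mulr0.
Qed.

Lemma measurable_integral_itv :
  measurable_fun setT (fun w => (\int[mu]_(u in `[a, b]) (G (u, w))%:E)%E).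
Proof.
under eq_fun do rewrite fE.
exact: measurable_fun_fubini_tonelli_G.
Qed.

Lemma tonelli_itv : (\int[P]_w \int[mu]_(u in `[a, b]) (G (u, w))%:E =
  \int[mu]_(u in `[a, b]) \int[P]_w (G (u, w))%:E)%E.
Proof.
under eq_integral do rewrite fE.
rewrite -(fubini_tonelli (m1 := mu) (m2 := P) f mf f0) [RHS]integral_mkcond.
apply: eq_integral => u _; rewrite patchE /f; case: ifPn => ab /=.
  by apply: eq_integral => w _; rewrite indicE /= ab mulr1.
by apply: integral0_eq => w _; rewrite indicE /= (negbTE ab) mulr0.
Qed.

End tonelli_interval.

End joint_measurability.

(** * Superposing the blocks of a time integral *)

Section periodic_split.
Context {R : realType}.
Local Notation mu := (@lebesgue_measure R).

Lemma continuous_itv_integrable (g : R -> R) (a b : R) : continuous g ->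
  mu.-integrable `[a, b] (EFin \o g).
Proof.
move=> cg; apply: continuous_compact_integrable; first exact: segment_compact.
exact: continuous_subspaceT.
Qed.

Lemma Rintegral_itv_shift (g : R -> R) (c h : R) : 0 <= h -> continuous g ->
  \int[mu]_(x in `[c, c + h]) g x = \int[mu]_(x in `[0, h]) g (c + x).
Proof.
move=> h0 cg; rewrite /Rintegral.
have cshift : continuous (fun x : R => c + x).
  by move=> x; apply: cvgD; [exact: cvg_cst | exact: cvg_id].
have dF : (fun x : R => c + x)^`()%classic = cst 1.
  apply/funext => x; rewrite derive1E; apply: derive_val.
  have := @is_deriveD R R R (cst c) id x 1 0 1 _ _; rewrite add0r; exact.
have := @integration_by_substitution_increasing _ (fun x => c + x) g 0 h h0.
rewrite addr0 => E; congr fine; apply: etrans (E _ _ _ _ _ _) _.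
- by move=> x y _ _; rewrite ltrD2l.
- by rewrite dF => x _; exact: cvg_cst.
- by rewrite dF; exact: is_cvg_cst.
- by rewrite dF; exact: is_cvg_cst.
- split; first by move=> x _; exact: derivableD.
  + by apply: cvg_at_right_filter; exact: cshift.
  + by apply: cvg_at_left_filter; exact: cshift.
- exact: continuous_subspaceT.
- by apply: eq_integral => x _; rewrite dF /= mulr1.
Qed.

Lemma Rintegral_itv_split (g : R -> R) (h : R) n : 0 < h -> continuous g ->
  \int[mu]_(x in `[0, n%:R * h]) g x =
  \int[mu]_(u in `[0, h]) (\sum_(k < n) g (k%:R * h + u)).
Proof.
move=> h0 cg.
have cshift c : continuous (fun u => g (c + u)).
  move=> u; apply: (@cvg_comp _ _ _ (fun u => c + u) g _ (nbhs (c + u))).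
    by apply: cvgD; [exact: cvg_cst | exact: cvg_id].
  exact: cg.
elim: n => [|n IH].
  rewrite mul0r set_itv1 Rintegral_set1.
  under eq_Rintegral do rewrite big_ord0.
  by rewrite Rintegral_cst// mul0r.
have nh : 0 <= n%:R * h by rewrite mulr_ge0// ltW.
have nh1 : n.+1%:R * h = n%:R * h + h by rewrite -natr1 mulrDl mul1r.
under [RHS]eq_Rintegral do rewrite big_ord_recr /=.
rewrite RintegralD//; last 2 first.
- apply: continuous_itv_integrable => u.
  by apply: cvg_big => [|k _]; [exact: add_continuous | exact: cshift].
- exact: continuous_itv_integrable.
rewrite -IH -Rintegral_itv_shift; [|exact: ltW|exact: cg].
rewrite -nh1; apply/eqP; rewrite addrC -subr_eq; apply/eqP.
have ig := continuous_itv_integrable g 0 (n.+1%:R * h) cg.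
(* Subtraction leaves the half-open interval []nh, (n+1)h]]; closing it adds a null set. *)
rewrite (@Rintegral_itvB _ g (BLeft 0) (BRight (n.+1%:R * h)) (n%:R * h) ig).
- rewrite Rintegral_itv_obnd_cbnd//.
  apply: integrableS (continuous_itv_integrable g (n%:R * h) (n.+1%:R * h) cg) => //.
  by apply: subset_itvr; rewrite bnd_simp.
- by rewrite bnd_simp.
- by rewrite bnd_simp ler_wpM2r ?ler_nat// ltW.
Qed.

End periodic_split.

(** * Consistency of the estimator *)

(** Inversion is total, with [0^-1 = 0]: it is continuous off 0, and the singleton is treated apart.
    This covers paths on which the denominator of [mle] vanishes. *)
Lemma measurable_inv_fun {R : realType} :
  measurable_fun setT (GRing.inv : R -> R).
Proof.
have -> : [set: R] = [set 0] `|` [set x | x != 0].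
  apply/esym/seteqP; split => // x _ /=.
  by have [->|x0] := eqVneq x 0; [left | right].
have o0 : open [set x : R | x != 0] by exact: open_neq.
apply/measurable_funU => //; first exact: open_measurable.
split; first exact: measurable_fun_set1.
apply: open_continuous_measurable_fun => // x /set_mem /= x0.
exact: inv_continuous.
Qed.

Section mle_consistency.
Context {d} {T : measurableType d} {R : realType} {P : probability T R}.
Variables (W xi : R -> {RV P >-> R}) (theta h : R).
Hypotheses (theta0 : 0 < theta) (h0 : 0 < h) (hW : bilateral_wiener W)
  (hxi : ornstein_uhlenbeck W theta xi).
Local Notation mu := (@lebesgue_measure R).
Local Notation v := ((2 * theta)^-1).

Let cxi w : continuous (fun t => xi t w) := ou_continuous hxi w.

Let cxi2 w : continuous (fun t => xi t w ^+ 2).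
Proof.
move=> t; apply: (@cvg_comp _ _ _ (fun u => xi u w) (fun x => x ^+ 2) _
  (nbhs (xi t w))); first exact: cxi.
exact: exprn_continuous.
Qed.

Definition grid_dev n (z : R * T) : R :=
  `|\sum_(k < n) (xi (k%:R * h + z.1) z.2 ^+ 2 - v)|.

(** Kept extended-real so that Tonelli and Markov apply without prior integrability, and not
    normalized: it is to be compared with multiples of n. *)
Definition path_dev n (w : T) : \bar R :=
  (\int[mu]_(u in `[0%R, h]) (grid_dev n (u, w))%:E)%E.

Lemma continuous_sqr_shift (c : R) w : continuous (fun u => xi (c + u) w ^+ 2 - v).
Proof.
move=> u; apply: cvgB; last exact: cvg_cst.
apply: (@cvg_comp _ _ _ (fun u => c + u) (fun t => xi t w ^+ 2) _
  (nbhs (c + u))); last exact: cxi2.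
by apply: cvgD; [exact: cvg_cst | exact: cvg_id].
Qed.

Lemma continuous_grid n w :
  continuous (fun u => \sum_(k < n) (xi (k%:R * h + u) w ^+ 2 - v)).
Proof.
move=> u; apply: (@cvg_big R _ +%R 0) => [|k _]; first exact: add_continuous.
exact: continuous_sqr_shift.
Qed.

Lemma grid_dev_measurable n : measurable_fun setT (grid_dev n).
Proof.
apply: (@measurable_joint _ _ _
  (fun u w => `|\sum_(k < n) (xi (k%:R * h + u) w ^+ 2 - v)|)).
  move=> u; apply: measurableT_comp => //; apply: measurable_sum => k.
  by apply: measurable_funB => //; exact: measurable_funX.
by move=> w u; exact: cvg_norm (continuous_grid n w u).
Qed.

Lemma path_dev_measurable n : measurable_fun setT (path_dev n).
Proof.
apply: measurable_integral_itv; first exact: grid_dev_measurable.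
by move=> z; exact: normr_ge0.
Qed.

(** After Tonelli the inner expectation has a bound constant in [u], whence the factor [h]. [dl]
    stays free, to be taken proportional to n. *)
Lemma integral_path_dev : exists C : R, 0 < C /\ forall n dl, 0 < dl ->
  (\int[P]_w path_dev n w <= (h * (dl + dl^-1 * (C * n%:R)))%:E)%E.
Proof.
have [C [C0 HC]] := ou_grid_avg_dist W xi theta h theta0 h0 hW hxi.
exists C; split=> // n dl dl0; rewrite tonelli_itv; [|exact: grid_dev_measurable|by move=> z; exact: normr_ge0].
set K := dl + _; have K0 : 0 <= K by rewrite addr_ge0 ?mulr_ge0 ?invr_ge0// ltW.
apply: (@le_trans _ _ (\int[mu]_(u in `[0%R, h]) K%:E)%E); last first.
  by rewrite integral_cst//= lebesgue_measure_itv/= lte_fin h0 sube0 -EFinM mulrC.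
apply: ge0_le_integral => //.
- by move=> u _; apply: integral_ge0 => w _; rewrite lee_fin normr_ge0.
- apply: measurable_funTS.
  apply: (@measurable_fun_fubini_tonelli_F _ _ _ _ _ P (EFin \o grid_dev n)).
    by apply/measurable_EFinP; exact: grid_dev_measurable.
  by move=> z; rewrite lee_fin normr_ge0.
move=> u _; apply: le_trans (_ : _ <= (\int[P]_w grid_dev n (u, w))%:E)%E _.
  have ig : P.-integrable setT (EFin \o
      (fun w => \sum_(k < n) (xi (k%:R * h + u) w ^+ 2 - v))).
    apply: integrable_bigsum => k.
    have [_ i2] := ou_sqint _ _ _ hW hxi (k%:R * h + u).
    exact: (integrableB measurableT i2 (integrable_cstP v)).
  rewrite fineK//; apply: integrable_fin_num => //.
  exact: (integrable_norm ig).
by rewrite lee_fin; exact: HC.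
Qed.

Lemma path_avg_dist n w :
  (`|\int[mu]_(t in `[0%R, (n%:R * h)%R]) (xi t w ^+ 2) - n%:R * h * v|%:E <=
  path_dev n w)%E.
Proof.
have cg : continuous (fun t => xi t w ^+ 2 - v).
  by have := continuous_sqr_shift 0 w; under eq_fun do rewrite add0r.
have cg2 := cxi2 w.
have nh : 0 <= n%:R * h by rewrite mulr_ge0// ltW.
have icst : mu.-integrable `[0, n%:R * h] (EFin \o (fun=> v)).
  by apply: continuous_itv_integrable => ?; exact: cvg_cst.
have -> : \int[mu]_(t in `[0, n%:R * h]) (xi t w ^+ 2) - n%:R * h * v =
    \int[mu]_(t in `[0, n%:R * h]) (xi t w ^+ 2 - v).
  rewrite RintegralB//; last exact: continuous_itv_integrable.
  congr (_ - _); rewrite Rintegral_cst//= lebesgue_measure_itv/= lte_fin.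
  case: ltP => [nh0|nh0]; first by rewrite -EFinB/= subr0 mulrC.
  by rewrite /= mulr0 (@le_anti _ _ (n%:R * h) 0) ?mul0r// nh nh0.
rewrite Rintegral_itv_split//.
have is_ := continuous_itv_integrable _ 0 h (continuous_grid n w).
apply: le_trans (_ : _ <= (\int[mu]_(u in `[0%R, h]) grid_dev n (u, w))%:E)%E _.
  by rewrite lee_fin; exact: le_normr_Rintegral.
rewrite fineK//; apply: integrable_fin_num => //; exact: integrable_norm.
Qed.

(** Markov's inequality with a bound independent of [t], as required by the moving endpoint
    [n h]. *)
Lemma markov_sqr t K : 0 < K ->
  (P [set w | (K <= xi t w ^+ 2)%R] <= (v / K)%:E)%E.
Proof.
move=> K0; have [m2 i2] := ou_sqint _ _ _ hW hxi t.
have mx : measurable_fun setT (fun w => (xi t w ^+ 2)%:E).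
  exact/measurable_EFinP/measurable_funX.
have := le_integral_abse P measurableT mx K0.
rewrite setTI.
have -> : [set x | (K%:E <= `|(xi t x ^+ 2)%:E|)%E] = [set w | K <= xi t w ^+ 2].
  by apply/seteqP; split => w /=; rewrite lee_fin ger0_norm ?sqr_ge0.
rewrite (eq_integral (fun w => (xi t w ^+ 2)%:E)); last first.
  by move=> w _ /=; rewrite ger0_norm ?sqr_ge0.
have <- : ((\int[P]_w xi t w ^+ 2)%:E = \int[P]_w (xi t w ^+ 2)%:E)%E.
  by rewrite fineK//; exact: integrable_fin_num.
rewrite (ou_moment2 _ _ _ theta0 hW hxi) => H.
by rewrite EFinM muleC lee_pdivlMl.
Qed.

Lemma path_dev_small eta e : 0 < eta -> 0 < e -> \forall n \near \oo,
  (P [set w | ((eta * n%:R)%:E <= path_dev n w)%E] <= e%:E)%E.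
Proof.
move=> eta0 e0; have [C [C0 HC]] := integral_path_dev.
(* Used with [dl * n], this makes the mean of [path_dev] at most [eta * n * (e / 2)], half of the
   Markov budget, plus the constant [h * C / dl], which [hn] below fits into the other half. *)
pose dl := e * eta / (2 * h).
have dl0 : 0 < dl by rewrite divr_gt0// mulr_gt0.
near=> n.
have hn : 2 * h * C / (dl * eta * e) <= n%:R by near: n; exact: nbhs_infty_ger.
have n0 : 0 < n%:R :> R.
  by apply: lt_le_trans hn; do ![apply: divr_gt0 | apply: mulr_gt0].
have a0 : 0 < eta * n%:R by rewrite mulr_gt0.
have pd0 w : (0 <= path_dev n w)%E.
  by apply: integral_ge0 => u _; rewrite lee_fin normr_ge0.
have := le_integral_abse P measurableT (path_dev_measurable n) a0.
rewrite setTI.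
have -> : [set x | ((eta * n%:R)%:E <= `|path_dev n x|)%E] =
    [set w | ((eta * n%:R)%:E <= path_dev n w)%E].
  by apply/seteqP; split => w /=; rewrite gee0_abs.
rewrite (eq_integral (path_dev n)); last by move=> w _; rewrite gee0_abs.
move=> H; rewrite -(@lee_pmul2l _ (eta * n%:R)%:E)// ?lte_fin//.
have dn0 : 0 < dl * n%:R by rewrite mulr_gt0.
apply: le_trans H (le_trans (HC n _ dn0) _).
rewrite -EFinM lee_fin.
have -> : (dl * n%:R)^-1 * (C * n%:R) = C / dl by field; rewrite !gt_eqF.
have -> : h * (dl * n%:R + C / dl) = eta * n%:R * (e / 2) + h * C / dl.
  by rewrite /dl; field; rewrite !gt_eqF.
suff : h * C / dl <= eta * n%:R * (e / 2) by lra.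
have dee0 : 0 < dl * eta * e by apply: mulr_gt0 => //; apply: mulr_gt0.
move: hn; rewrite ler_pdivrMr// => hn.
rewrite ler_pdivrMr//.
have -> : eta * n%:R * (e / 2) * dl = (n%:R * (dl * eta * e)) / 2 by field.
by rewrite ler_pdivlMr//; lra.
Unshelve. all: by end_near. Qed.

(** Pathwise perturbation bound. [eta <= v / 2] keeps the time average [a] above [v / 2], so the
    denominator [2 * a] is at least [v = 1 / (2 theta)]; the numerator error is at most
    [(1 + 2 theta) eta], and [2 theta (1 + 2 theta) <= 4 theta (1 + theta)]. *)
Lemma mle_close n w eta : (0 < n)%N -> 0 < eta -> eta <= v / 2 ->
  ~ ((eta * h * n%:R)%:E <= path_dev n w)%E ->
  xi 0 w ^+ 2 <= eta * (n%:R * h) -> xi (n%:R * h) w ^+ 2 <= eta * (n%:R * h) ->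
  `|mle xi (n%:R * h) w - theta| <= 4 * theta * (1 + theta) * eta.
Proof.
move=> n0 eta0 etav /negP; rewrite -ltNge => dev x0 xn.
set S := n%:R * h in x0 xn *; have S0 : 0 < S by rewrite mulr_gt0// ltr0n.
have := le_lt_trans (path_avg_dist n w) dev; rewrite lte_fin -/S.
have -> : eta * h * n%:R = eta * S by rewrite /S; ring.
rewrite /mle; set I := \int[mu]_(t in _) _ => dI.
set p := xi 0 w ^+ 2 / S; set q := xi S w ^+ 2 / S; set a := I / S.
have p1 : 0 <= p <= eta by apply/andP; split; [exact: divr_ge0 (sqr_ge0 _) (ltW S0) | rewrite /p ler_pdivrMr].
have q1 : 0 <= q <= eta by apply/andP; split; [exact: divr_ge0 (sqr_ge0 _) (ltW S0) | rewrite /q ler_pdivrMr].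
have va : `|a - v| <= eta.
  have -> : a - v = (I - S * v) / S by rewrite /a; field; rewrite !gt_eqF.
  by rewrite normrM [X in _ * X]gtr0_norm ?invr_gt0// ler_pdivrMr// ltW.
have v0 : 0 < v by rewrite invr_gt0 mulr_gt0.
(* This cancels the leading term: the numerator becomes a combination of the small quantities
   [p - q] and [a - v]. *)
have tv : 2 * theta * v = 1 by rewrite divff// gt_eqF// mulr_gt0.
move: va; rewrite ler_norml => /andP[va1 va2].
have av : v / 2 <= a by lra.
have a0 : 0 < a by lra.
have -> : 2 / S * I = 2 * a by rewrite /a; field; rewrite gt_eqF.
have -> : (1 + p - q) / (2 * a) - theta = (1 + p - q - 2 * theta * a) / (2 * a).
  by field; rewrite gt_eqF.
have a20 : 0 < 2 * a by rewrite mulr_gt0.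
rewrite normrM (@gtr0_norm _ (2 * a)^-1) ?invr_gt0// ler_pdivrMr//.
have num : `|1 + p - q - 2 * theta * a| <= (1 + 2 * theta) * eta.
  have -> : 1 + p - q - 2 * theta * a = (p - q) - 2 * theta * (a - v).
    by rewrite mulrBr tv; ring.
  move: p1 q1 => /andP[p0 p1] /andP[q0 q1]; rewrite ler_norml.
  by apply/andP; split; nra.
apply: le_trans num _.
apply: le_trans (_ : _ <= 4 * theta * (1 + theta) * eta * v) _.
  have -> : 4 * theta * (1 + theta) * eta * v = (2 * theta * v) * (2 * (1 + theta) * eta).
    by ring.
  by rewrite tv mul1r; nra.
by rewrite ler_pM2l ?mulr_gt0 ?addr_gt0//; lra.
Qed.

Lemma mle_measurable S : measurable_fun setT (mle xi S).
Proof.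
have mI : measurable_fun setT
    (fun w => (\int[mu]_(t in `[0%R, S]) (xi t w ^+ 2)%:E)%E).
  apply: (measurable_integral_itv 0 S (fun z => xi z.1 z.2 ^+ 2)).
    apply: (@measurable_joint _ _ _ (fun t w => xi t w ^+ 2)) => //.
    by move=> t; exact: measurable_funX.
  by move=> z; exact: sqr_ge0.
apply: measurable_funM.
  apply: measurable_funB; first apply: measurable_funD => //.
    by apply: measurable_funM => //; exact: measurable_funX.
  by apply: measurable_funM => //; exact: measurable_funX.
apply: (measurableT_comp measurable_inv_fun); apply: measurable_funM => //.
exact: (measurableT_comp (fine_measurable measurableT) mI).
Qed.

End mle_consistency.

(** * The plug-in predictor *)

Section plugin_norm.
Context {R : realType} (h : R) (h0 : 0 < h).

(** A function of a real time rather than of a point of [segment h], so that continuity and rational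
    times on the line can be used. *)
Definition rho_gap (u v x t : R) : R :=
  `|expR (- u * t) * x - expR (- v * t) * x|.

Lemma expR_itv_le (u t : R) : 0 <= t -> t <= h -> expR (- u * t) <= expR (`|u| * h).
Proof.
move=> t0 th; rewrite ler_expR; apply: le_trans (_ : _ <= `|u| * t) _.
  by rewrite ler_wpM2r// -normrN ler_norm.
by rewrite ler_wpM2l.
Qed.

Lemma segment_itv (t : segment h) : 0 <= set_val t <= h.
Proof. by have := set_valP t; rewrite /= in_itv. Qed.

Let gapE (u v : R) (b : B h) (t : segment h) :
  `|B_sub (rho h0 u b) (rho h0 v b) t| =
  rho_gap u v (b (endpoint h0)) (set_val t).
Proof. by []. Qed.

Lemma supnorm_rho_le (u v c : R) (b : B h) :
  (forall t, 0 <= t -> t <= h -> rho_gap u v (b (endpoint h0)) t <= c) ->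
  supnorm (B_sub (rho h0 u b) (rho h0 v b)) <= c.
Proof.
move=> bnd; apply: ge_sup.
  by exists `|B_sub (rho h0 u b) (rho h0 v b) (endpoint h0)|, (endpoint h0).
move=> _ [t _ <-]; rewrite gapE.
by have /andP[t0 th] := segment_itv t; exact: bnd.
Qed.

Let gap_le_supnorm (u v : R) (b : B h) (t : segment h) :
  rho_gap u v (b (endpoint h0)) (set_val t) <=
  supnorm (B_sub (rho h0 u b) (rho h0 v b)).
Proof.
apply: ub_le_sup; last by exists t => //; rewrite gapE.
(* [sup] is known to dominate its set only when the set is bounded; [u] and [v] may be negative
   here, hence the absolute values. *)
exists ((expR (`|u| * h) + expR (`|v| * h)) * `|b (endpoint h0)|).
move=> _ [s _ <-]; rewrite gapE /rho_gap -mulrBl normrM ler_wpM2r//.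
have /andP[s0 sh] := segment_itv s.
apply: le_trans (ler_normB _ _) _.
by rewrite !(gtr0_norm (expR_gt0 _)) lerD// expR_itv_le.
Qed.

Lemma supnorm_rho_ge0 (u v : R) (b : B h) :
  0 <= supnorm (B_sub (rho h0 u b) (rho h0 v b)).
Proof. exact: le_trans (normr_ge0 _) (gap_le_supnorm u v b (endpoint h0)). Qed.

Lemma continuous_rho_gap (u v x : R) : continuous (rho_gap u v x).
Proof. by move=> t; apply: cvg_norm; apply: cvgB; exact: rho_continuous. Qed.

(** The continuous retraction of the line onto [[0, h]]: it lets every rational serve as a time, and
    its values at rationals are dense in the segment. *)
Definition clamp (q : R) : R := Num.max 0 (Num.min q h).

Lemma clamp_itv q : 0 <= clamp q <= h.
Proof.
by rewrite /clamp le_max lexx /= ge_max ge_min lexx orbT andbT ltW.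
Qed.

Lemma clamp_id t : 0 <= t -> t <= h -> clamp t = t.
Proof. by move=> t0 th; rewrite /clamp min_l// max_r. Qed.

Lemma continuous_clamp : continuous clamp.
Proof.
move=> t; apply: (@continuous_max _ _ (cst 0) (fun q => Num.min q h)).
  exact: cvg_cst.
by apply: (@continuous_min _ _ id (cst h)); [exact: cvg_id | exact: cvg_cst].
Qed.

(** The times where the gap exceeds [e] form an open set after clamping, hence contain a rational.
    This makes the sup-norm event a countable union. *)
Lemma supnorm_rho_gtP (u v e : R) (b : B h) :
  e < supnorm (B_sub (rho h0 u b) (rho h0 v b)) <->
  exists q : rat, e < rho_gap u v (b (endpoint h0)) (clamp (ratr q)).
Proof.
set x := b (endpoint h0); split.
  move=> /sup_gt[]; first by exists `|B_sub (rho h0 u b) (rho h0 v b) (endpoint h0)|, (endpoint h0).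
  move=> _ [t _ <-]; rewrite gapE -/x => et.
  have /andP[t0 th] := segment_itv t.
  pose A : set R := (fun q => rho_gap u v x (clamp q)) @^-1` [set y | e < y].
  have oA : open A.
    apply: open_comp; last exact: open_gt.
    move=> q _; apply: (@cvg_comp _ _ _ clamp (rho_gap u v x) _ (nbhs (clamp q))).
      exact: continuous_clamp.
    exact: continuous_rho_gap.
  have A0 : A !=set0 by exists (set_val t); rewrite /A /= clamp_id.
  have [q [Aq [r _ rq]]] := dense_rat A0 oA.
  by exists r; rewrite rq.
move=> [q eq]; have /andP[c0 ch] := clamp_itv (ratr q).
have cI : clamp (ratr q) \in `[0, h]%classic by rewrite inE /= in_itv /= c0.
exact: lt_le_trans eq (gap_le_supnorm u v b (exist _ (clamp (ratr q)) cI)).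
Qed.

(** [exp (- a)] is 1-Lipschitz on nonnegative [a], from [1 - exp (- y) <= y]; the signs of [u] and
    [v] keep both exponents in that range. *)
Lemma rho_gap_le (u v x t : R) : 0 <= u -> 0 <= v -> 0 <= t -> t <= h ->
  rho_gap u v x t <= h * `|u - v| * `|x|.
Proof.
move=> u0 v0 t0 th; rewrite /rho_gap -mulrBl normrM ler_wpM2r//.
have lip (a c : R) : 0 <= a -> a <= c -> `|expR (- a) - expR (- c)| <= c - a.
  move=> a0 ac; rewrite ger0_norm; last by rewrite subr_ge0 ler_expR lerN2.
  have -> : expR (- a) - expR (- c) = expR (- a) * (1 - expR (- (c - a))).
    by rewrite mulrBr mulr1 -expRD; congr (_ - expR _); ring.
  have h1 := expR_ge1Dx (- (c - a)).
  have h2 : expR (- (c - a)) <= 1 by rewrite -expR0 ler_expR oppr_le0 subr_ge0.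
  have h3 : expR (- a) <= 1 by rewrite -expR0 ler_expR oppr_le0.
  have h4 := expR_gt0 (- a).
  by nra.
apply: le_trans (_ : _ <= `|u * t - v * t|) _.
  rewrite !mulNr; have [uv|/ltW uv] := lerP (u * t) (v * t).
    by rewrite lip ?mulr_ge0.
  by rewrite distrC lip ?mulr_ge0.
by rewrite -mulrBl normrM mulrC (ger0_norm t0) ler_wpM2r.
Qed.

End plugin_norm.

Lemma cvge0_le {R : realType} (u : nat -> \bar R) : (forall n, (0 <= u n)%E) ->
  (forall e : R, 0 < e -> \forall n \near \oo, (u n <= e%:E)%E) ->
  u @ \oo --> 0%E.
Proof.
move=> u0 ue; apply: cvg_EFin.
  apply: filterS (ue 1 ltr01) => n un.
  by rewrite ge0_fin_numE// (le_lt_trans un)// ltry.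
apply/cvgr0Pnorm_le => e /[dup] e0 /ue; apply: filterS => n un.
by rewrite /= ger0_norm ?fine_ge0// -lee_fin fineK// ge0_fin_numE//
  (le_lt_trans un)// ltry.
Qed.

Theorem corollary2 (R : realType) (d : measure_display) (T : measurableType d)
    (P : probability T R) (theta h : R) (theta0 : 0 < theta) (h0 : 0 < h)
    (W xi : R -> {RV P >-> R}) (hW : bilateral_wiener W)
    (hxi : ornstein_uhlenbeck W theta xi) :
  let X (n : int) (w : T) : B h := block h (ou_continuous hxi w) n in
  let theta_hat (n : nat) (w : T) : R := mle xi (n%:R * h) w in
  cvg_in_probability P
    (fun n w => supnorm (B_sub (rho h0 theta (X (n%:Z - 1) w))
                               (rho h0 (theta_hat n w) (X (n%:Z - 1) w))))
    (cst 0).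
Proof.
move=> X theta_hat e e0.
(* Block [n - 1] ends at time [(n - 1) h + h = n h], the right end of the observation window. *)
have XE n w : X (n%:Z - 1) w (endpoint h0) = xi (n%:R * h) w.
  rewrite /X /=; congr (xi _ w).
  by rewrite intrD mulrDl mulrN1z mulNr mul1r addrNK -pmulrn.
have evE n : [set w | e < `|supnorm (B_sub (rho h0 theta (X (n%:Z - 1) w))
      (rho h0 (theta_hat n w) (X (n%:Z - 1) w))) - cst 0 w|] =
    \bigcup_(q : rat) [set w |
      e < rho_gap theta (theta_hat n w) (xi (n%:R * h) w) (clamp h (ratr q))].
  apply/seteqP; split => w /=; rewrite subr0 ger0_norm ?supnorm_rho_ge0//.
    by move=> /supnorm_rho_gtP[q]; rewrite XE; exists q.
  by move=> [q _ /= wq]; apply/supnorm_rho_gtP; exists q; rewrite XE.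
apply: cvge0_le => [n|eps eps0]; first exact: measure_ge0.
have v0 : 0 < (2 * theta)^-1 by rewrite invr_gt0 mulr_gt0.
set v := (2 * theta)^-1 in v0.
(* Each Markov bound becomes [eps / 4]. [K = K2 + 1] bounds [|x|] when [x ^+ 2 < K2], without a
   square root. *)
pose K2 := 4 * v / eps; have K20 : 0 < K2 by rewrite divr_gt0// mulr_gt0.
have vK : v / K2 = eps / 4 by rewrite /K2; field; rewrite !gt_eqF.
pose K := K2 + 1; have K0 : 0 < K by rewrite addr_gt0.
have sqrK x : x ^+ 2 < K2 -> `|x| <= K.
  by rewrite -real_normK ?num_real// leNgt => xK; apply/negP; rewrite /K => Kx; nra.
(* Tolerance for the estimator: [r <= theta] makes it nonnegative, and [h * r * K <= e] controls the
   predictor. [eta] below then meets the condition of [mle_close] and gives [c * eta <= r]. *)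
pose r := Num.min theta (e / (h * K)).
have r0 : 0 < r by rewrite lt_min theta0 divr_gt0// mulr_gt0.
pose c := 4 * theta * (1 + theta).
have c0 : 0 < c by do !apply: mulr_gt0 => //; rewrite addr_gt0.
pose eta := Num.min (v / 2) (r / c).
have eta0 : 0 < eta by rewrite lt_min !divr_gt0.
have eh0 : 0 < eta * h by rewrite mulr_gt0.
have eps2 : 0 < eps / 2 by rewrite divr_gt0.
have small := path_dev_small W xi theta h theta0 h0 hW hxi (eta * h) (eps / 2) eh0 eps2.
near=> n.
have n0 : (0 < n)%N by near: n; exact: nbhs_infty_gt.
have Kn : K2 / (eta * h) <= n%:R by near: n; exact: nbhs_infty_ger.
have pdn : (P [set w | ((eta * h * n%:R)%:E <= path_dev xi theta h n w)%E] <= (eps / 2)%:E)%E.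
  by near: n.
pose Z := [set w | ((eta * h * n%:R)%:E <= path_dev xi theta h n w)%E].
pose V t := [set w | K2 <= xi t w ^+ 2].
have mV t : measurable (V t).
  have mx : measurable_fun setT (fun w => xi t w ^+ 2) by exact: measurable_funX.
  rewrite [V t](_ : _ = [set: T] `&` (fun w => xi t w ^+ 2) @^-1` `[K2, +oo[).
    by apply: mx => //; exact: measurable_itv.
  by rewrite setTI; apply/seteqP; split => w; rewrite /V /= in_itv /= andbT.
have mZ : measurable Z.
  have mp := path_dev_measurable W xi theta h hxi n.
  rewrite -[Z]setTI; exact: (emeasurable_fun_c_infty measurableT mp).
(* Needed for [le_measure]: the event must be measurable before it is bounded by the three
   exceptional ones. *)
have mE : measurable [set w | e < `|supnorm (B_sub (rho h0 theta (X (n%:Z - 1) w))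
      (rho h0 (theta_hat n w) (X (n%:Z - 1) w))) - cst 0 w|].
  rewrite evE; apply: bigcupT_measurable_rat => q.
  have mhat : measurable_fun setT (theta_hat n).
    exact: (mle_measurable W xi theta hxi (n%:R * h)).
  have mgap : measurable_fun setT (fun w =>
      rho_gap theta (theta_hat n w) (xi (n%:R * h) w) (clamp h (ratr q))).
    apply: measurableT_comp => //; apply: measurable_funB; apply: measurable_funM => //.
    apply: measurableT_comp => //; apply: measurable_funM => //.
    by apply: measurableT_comp.
  rewrite [X in measurable X](_ : _ = [set: T] `&` (fun w => rho_gap theta
    (theta_hat n w) (xi (n%:R * h) w) (clamp h (ratr q))) @^-1` `]e, +oo[).
    by apply: mgap => //; exact: measurable_itv.
  by rewrite setTI; apply/seteqP; split => w /=; rewrite in_itv /= andbT.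
apply: (@le_trans _ _ (P (V 0 `|` V (n%:R * h) `|` Z))); last first.
  apply: le_trans (measureU2 _ _ _) _ => //; first exact: measurableU.
  have -> : eps%:E = ((eps / 4 + eps / 4)%:E + (eps / 2)%:E)%E.
    by rewrite -EFinD; congr EFin; field.
  apply: leeD => //; apply: le_trans (measureU2 _ _ _) _ => //.
  by rewrite EFinD -vK; apply: leeD; exact: (markov_sqr W xi theta theta0 hW hxi).
apply: le_measure; rewrite ?inE//.
  by do !apply: measurableU.
move=> w /= We; apply: contrapT => /not_orP[/not_orP[nV0 nVn] nZ].
have {nV0} x0 : xi 0 w ^+ 2 < K2 by rewrite ltNge; apply/negP.
have {nVn} xn : xi (n%:R * h) w ^+ 2 < K2 by rewrite ltNge; apply/negP.
have K2S : K2 <= eta * (n%:R * h).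
  by move: Kn; rewrite ler_pdivrMr//; lra.
have hat : `|theta_hat n w - theta| <= r.
  apply: le_trans (mle_close W xi theta h theta0 h0 hxi n w eta n0 eta0 _ nZ _ _) _.
  - by rewrite ge_min lexx.
  - by apply: le_trans (ltW x0) _.
  - by apply: le_trans (ltW xn) _.
  by rewrite -/c mulrC -ler_pdivlMr// ge_min lexx orbT.
have hat0 : 0 <= theta_hat n w.
  have rt : r <= theta by rewrite ge_min lexx.
  by move: hat; rewrite ler_norml => /andP[]; lra.
move: We; rewrite subr0 ger0_norm ?supnorm_rho_ge0//; apply/negP; rewrite -leNgt.
apply: supnorm_rho_le => t t0 th; rewrite XE.
apply: le_trans (rho_gap_le h _ _ _ _ (ltW theta0) hat0 t0 th) _.
rewrite distrC; apply: le_trans (_ : _ <= h * r * K) _.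
  by rewrite ler_pM ?mulr_ge0 ?(ltW h0)// ?sqrK// ler_pM2l.
have : r <= e / (h * K) by rewrite ge_min lexx orbT.
by rewrite ler_pdivlMr ?mulr_gt0//; lra.
Unshelve. all: by end_near. Qed.
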